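(* Let $m>2$ and let $M$ be a real $(2m+1)$-dimensional cosymplectic manifold with structure tensors $(\varphi_i^h,\xi^h,\eta_i,g_{ij})$. If $M$ admits a cosymplectic conformal connection $D$ which is of zero curvature (that is, the curvature tensor $R_{kji}^h$ of $D$ vanishes identically), then the cosymplectic Bochner curvature tensor $B_{kji}^h$ of $M$ vanishes identically.
   Context: Everything is smooth, the summation convention is used, and indices of tensors are raised and lowered with $g$. An almost contact metric structure on a $(2m+1)$-dimensional manifold $M$ consists of a $(1,1)$-tensor field $\varphi_i^h$, a vector field $\xi^h$, a $1$-form $\eta_i$ and a Riemannian metric $g_{ij}$ satisfying $$\varphi_j^i\varphi_i^h=-\delta_j^h+\eta_j\xi^h,\quad \varphi_i^h\xi^i=0,\quad \eta_i\varphi_j^i=0,\quad \eta_i\xi^i=1,\quad g_{ts}\varphi_j^t\varphi_i^s=g_{ji}-\eta_j\eta_i,\quad \eta_i=g_{ih}\xi^h.$$ Write $\eta^h=g^{hi}\eta_i=\xi^h$ and $\varphi_{ji}=\varphi_j^t g_{ti}$ (which is skew-symmetric). $M$ is called cosymplectic if $\nabla_j\varphi_i^h=0$ and $\nabla_i\xi^h=0$, where $\nabla$ is the Levi-Civita connection of $g$. For an affine connection $D$ with components $\Gamma_{ji}^h$, $D_jv^h=\partial_jv^h+\Gamma_{ji}^hv^i$. A cosymplectic conformal connection on a cosymplectic manifold $M$ is an affine connection $D$ for which there exist a scalar function $p$ (with $p_i=\partial_i p$) and a vector field $q^h$ on $M$ such that $$D_k(e^{2p}g_{ji})=2e^{2p}p_k\eta_j\eta_i,\qquad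 D_j\varphi_i^h=0,\qquad D_j\eta^h=0,\qquad \Gamma_{ji}^h-\Gamma_{ij}^h=-2\varphi_{ji}q^h .$$ Its curvature tensor is $R_{kji}^h=\partial_k\Gamma_{ji}^h-\partial_j\Gamma_{ki}^h+\Gamma_{kt}^h\Gamma_{ji}^t-\Gamma_{jt}^h\Gamma_{ki}^t$. Let $K_{kji}^h$ be the curvature tensor of the Levi-Civita connection of $g$ (same sign convention), $K_{ji}=K_{tji}^t$ the Ricci tensor and $K=g^{ji}K_{ji}$ the scalar curvature. The cosymplectic Bochner curvature tensor of $M$ is $$\begin{aligned}B_{kji}^h={}&K_{kji}^h+(\delta_k^h-\eta_k\eta^h)L_{ji}-(\delta_j^h-\eta_j\eta^h)L_{ki}+L_k^h(g_{ji}-\eta_j\eta_i)-L_j^h(g_{ki}-\eta_k\eta_i)\\&+\varphi_k^hM_{ji}-\varphi_j^hM_{ki}+M_k^h\varphi_{ji}-M_j^h\varphi_{ki}-2(M_{kj}\varphi_i^h+\varphi_{kj}M_i^h),\end{aligned}$$ where $$L_{ji}=-\frac{1}{2(m+2)}\bigl(K_{ji}+L(g_{ji}-\eta_j\eta_i)\bigr),\quad L=g^{ji}L_{ji}=-\frac{K}{4(m+1)},\quad M_{ji}=-L_{jt}\varphi_i^t,\quad L_k^h=L_{kt}g^{th},\quad M_k^h=M_{kt}g^{th}.$$ *)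

(* Defs.v *)
From HB Require Import structures.
From mathcomp Require Import all_boot all_order all_algebra.
From mathcomp Require Import all_classical all_reals all_analysis.

Set Implicit Arguments.
Unset Strict Implicit.
Unset Printing Implicit Defensive.

Import Order.TTheory GRing.Theory Num.Theory.
Import numFieldNormedType.Exports.

Local Open Scope classical_set_scope.
Local Open Scope ring_scope.

(** Conventions.  A manifold of dimension [n.+1] is modelled on ['rV[R]_n.+1]
    (matrices carry a norm only for positive dimensions).  A tensor field is
    the family of its components in the charts of an atlas; the components in
    chart [a] are functions of the coordinates and are only meaningful on the
    open set [cod a].  Indices of a two-index object are written in the order
    they are read: [g x j i] is g_{ji}, [phi x i h] is phi_i^h; likewise
    [G x j i h] is Gamma_{ji}^h and [K k j i h] is K_{kji}^h. *)

Definition pd (R : realType) (n : nat) (f : 'rV[R]_n.+1 -> R) (i : 'I_n.+1)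
    (x : 'rV[R]_n.+1) : R :=
  'D_(delta_mx 0 i) (f : 'rV[R]_n.+1 -> R^o) x.

Fixpoint Ck (R : realType) (n k : nat) (U : set 'rV[R]_n.+1)
    (f : 'rV[R]_n.+1 -> R) : Prop :=
  (forall x, U x -> {for x, continuous f}) /\
  if k is k'.+1 then
    (forall x, U x -> forall i : 'I_n.+1,
       derivable (f : 'rV[R]_n.+1 -> R^o) x (delta_mx 0 i)) /\
    (forall i : 'I_n.+1, Ck k' U (pd f i))
  else True.

Definition smooth_on (R : realType) (n : nat) (U : set 'rV[R]_n.+1)
    (f : 'rV[R]_n.+1 -> R) : Prop :=
  forall k, Ck k U f.

Record smooth_manifold (R : realType) (n : nat) := SmoothManifold {
  carrier :> topologicalType;
  carrier_hausdorff : hausdorff_space carrier;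
  carrier_second_countable : @second_countable carrier;
  chart : Type;
  dom : chart -> set carrier;
  cod : chart -> set 'rV[R]_n.+1;
  coord : chart -> carrier -> 'rV[R]_n.+1;
  point_of : chart -> 'rV[R]_n.+1 -> carrier;
  dom_open : forall a, open (dom a);
  cod_open : forall a, open (cod a);
  dom_cover : forall p, exists a, dom a p;
  coord_cod : forall a p, dom a p -> cod a (coord a p);
  point_of_dom : forall a x, cod a x -> dom a (point_of a x);
  coordK : forall a p, dom a p -> point_of a (coord a p) = p;
  point_ofK : forall a x, cod a x -> coord a (point_of a x) = x;
  coord_continuous : forall a, {within dom a, continuous (coord a)};
  point_of_continuous : forall a, {within cod a, continuous (point_of a)};
  transition_smooth : forall a b h,
    smooth_on (cod a `&` point_of a @^-1` dom b)
      (fun x => coord b (point_of a x) 0 h)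
}.

Definition overlap (R : realType) (n : nat) (M : smooth_manifold R n)
    (a b : chart M) : set 'rV[R]_n.+1 :=
  cod a `&` point_of a @^-1` dom b.

Definition trans (R : realType) (n : nat) (M : smooth_manifold R n)
    (a b : chart M) (x : 'rV[R]_n.+1) : 'rV[R]_n.+1 :=
  coord b (point_of a x).

(** Jacobian of a change of coordinates: the entry (i, h) is d_i tau^h. *)
Definition jac (R : realType) (n : nat) (M : smooth_manifold R n)
    (a b : chart M) (x : 'rV[R]_n.+1) (i h : 'I_n.+1) : R :=
  pd (fun y => trans a b y 0 h) i x.

Record scalar_field (R : realType) (n : nat) (M : smooth_manifold R n) :=
  ScalarField {
  scalar_val : M -> R;
  scalar_smooth : forall a,
    smooth_on (cod a) (fun x => scalar_val (point_of a x))
}.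

Definition scalar_comp (R : realType) (n : nat) (M : smooth_manifold R n)
    (f : scalar_field M) (a : chart M) (x : 'rV[R]_n.+1) : R :=
  scalar_val f (point_of a x).

Record vector_field (R : realType) (n : nat) (M : smooth_manifold R n) :=
  VectorField {
  vec_comp :> chart M -> 'rV[R]_n.+1 -> 'rV[R]_n.+1;
  vec_smooth : forall a h, smooth_on (cod a) (fun x => vec_comp a x 0 h);
  vec_law : forall a b x h, overlap a b x ->
    vec_comp b (trans a b x) 0 h = \sum_i jac a b x i h * vec_comp a x 0 i
}.

Record one_form (R : realType) (n : nat) (M : smooth_manifold R n) :=
  OneForm {
  form_comp :> chart M -> 'rV[R]_n.+1 -> 'rV[R]_n.+1;
  form_smooth : forall a i, smooth_on (cod a) (fun x => form_comp a x 0 i);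
  form_law : forall a b x i, overlap a b x ->
    form_comp a x 0 i = \sum_h jac a b x i h * form_comp b (trans a b x) 0 h
}.

Record tensor11 (R : realType) (n : nat) (M : smooth_manifold R n) :=
  Tensor11 {
  t11_comp :> chart M -> 'rV[R]_n.+1 -> 'M[R]_n.+1;
  t11_smooth : forall a i h, smooth_on (cod a) (fun x => t11_comp a x i h);
  t11_law : forall a b x i h, overlap a b x ->
    \sum_k jac a b x i k * t11_comp b (trans a b x) k h =
    \sum_k t11_comp a x i k * jac a b x k h
}.

Record riemannian_metric (R : realType) (n : nat) (M : smooth_manifold R n) :=
  RiemannianMetric {
  metric_comp :> chart M -> 'rV[R]_n.+1 -> 'M[R]_n.+1;
  metric_smooth : forall a j i,
    smooth_on (cod a) (fun x => metric_comp a x j i);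
  metric_law : forall a b x j i, overlap a b x ->
    metric_comp a x j i =
    \sum_k \sum_l jac a b x j k * jac a b x i l *
      metric_comp b (trans a b x) k l;
  metric_sym : forall a x j i, cod a x ->
    metric_comp a x j i = metric_comp a x i j;
  metric_pos : forall a x (v : 'rV[R]_n.+1), cod a x -> v != 0 ->
    0 < \sum_j \sum_i metric_comp a x j i * v 0 j * v 0 i
}.

Record affine_connection (R : realType) (n : nat) (M : smooth_manifold R n) :=
  AffineConnection {
  conn_comp :> chart M -> 'rV[R]_n.+1 -> 'I_n.+1 -> 'I_n.+1 -> 'I_n.+1 -> R;
  conn_smooth : forall a j i h,
    smooth_on (cod a) (fun x => conn_comp a x j i h);
  conn_law : forall a b x j i h, overlap a b x ->
    \sum_k jac a b x k h * conn_comp a x j i k =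
    pd (fun y => jac a b y i h) j x +
    \sum_k \sum_l jac a b x j k * jac a b x i l *
      conn_comp b (trans a b x) k l h
}.

(** Covariant derivatives in one chart:
    [cov_vec G v x j h] is D_j v^h, [cov_t02 G T x k j i] is D_k T_{ji} and
    [cov_t11 G T x j i h] is D_j T_i^h. *)
Definition cov_vec (R : realType) (n : nat)
    (G : 'rV[R]_n.+1 -> 'I_n.+1 -> 'I_n.+1 -> 'I_n.+1 -> R)
    (v : 'rV[R]_n.+1 -> 'rV[R]_n.+1) (x : 'rV[R]_n.+1) (j h : 'I_n.+1) : R :=
  pd (fun y => v y 0 h) j x + \sum_i G x j i h * v x 0 i.

Definition cov_t02 (R : realType) (n : nat)
    (G : 'rV[R]_n.+1 -> 'I_n.+1 -> 'I_n.+1 -> 'I_n.+1 -> R)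
    (T : 'rV[R]_n.+1 -> 'M[R]_n.+1) (x : 'rV[R]_n.+1) (k j i : 'I_n.+1) : R :=
  pd (fun y => T y j i) k x
  - \sum_t G x k j t * T x t i - \sum_t G x k i t * T x j t.

Definition cov_t11 (R : realType) (n : nat)
    (G : 'rV[R]_n.+1 -> 'I_n.+1 -> 'I_n.+1 -> 'I_n.+1 -> R)
    (T : 'rV[R]_n.+1 -> 'M[R]_n.+1) (x : 'rV[R]_n.+1) (j i h : 'I_n.+1) : R :=
  pd (fun y => T y i h) j x
  + \sum_t G x j t h * T x i t - \sum_t G x j i t * T x t h.

Definition curvature (R : realType) (n : nat)
    (G : 'rV[R]_n.+1 -> 'I_n.+1 -> 'I_n.+1 -> 'I_n.+1 -> R)
    (x : 'rV[R]_n.+1) (k j i h : 'I_n.+1) : R :=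
  pd (fun y => G y j i h) k x - pd (fun y => G y k i h) j x
  + \sum_t G x k t h * G x j i t - \sum_t G x j t h * G x k i t.

Definition levi_civita (R : realType) (n : nat) (M : smooth_manifold R n)
    (g : riemannian_metric M) (N : affine_connection M) : Prop :=
  forall a x, cod a x ->
    (forall j i h, N a x j i h = N a x i j h) /\
    (forall k j i, cov_t02 (N a) (g a) x k j i = 0).

Definition zero_curvature (R : realType) (n : nat) (M : smooth_manifold R n)
    (D : affine_connection M) : Prop :=
  forall a x, cod a x -> forall k j i h, curvature (D a) x k j i h = 0.

(** [lower] is T_j^t g_{ti} and [raise] is T_{kt} g^{th}. *)
Definition lower (R : realType) (n : nat) (g T : 'M[R]_n.+1) : 'M[R]_n.+1 :=
  \matrix_(j, i) \sum_t T j t * g t i.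

Definition raise (R : realType) (n : nat) (g T : 'M[R]_n.+1) : 'M[R]_n.+1 :=
  \matrix_(k, h) \sum_t T k t * invmx g t h.

Record almost_contact_metric (R : realType) (n : nat)
    (M : smooth_manifold R n) := AlmostContactMetric {
  acm_phi : tensor11 M;
  acm_xi : vector_field M;
  acm_eta : one_form M;
  acm_g : riemannian_metric M;
  acm_phi_sq : forall a x, cod a x -> forall j h,
    \sum_i acm_phi a x j i * acm_phi a x i h =
    - (j == h)%:R + acm_eta a x 0 j * acm_xi a x 0 h;
  acm_phi_xi : forall a x, cod a x -> forall h,
    \sum_i acm_phi a x i h * acm_xi a x 0 i = 0;
  acm_eta_phi : forall a x, cod a x -> forall j,
    \sum_i acm_eta a x 0 i * acm_phi a x j i = 0;
  acm_eta_xi : forall a x, cod a x ->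
    \sum_i acm_eta a x 0 i * acm_xi a x 0 i = 1;
  acm_compat : forall a x, cod a x -> forall j i,
    \sum_t \sum_s acm_g a x t s * acm_phi a x j t * acm_phi a x i s =
    acm_g a x j i - acm_eta a x 0 j * acm_eta a x 0 i;
  acm_eta_g : forall a x, cod a x -> forall i,
    acm_eta a x 0 i = \sum_h acm_g a x i h * acm_xi a x 0 h
}.

Definition cosymplectic (R : realType) (n : nat) (M : smooth_manifold R n)
    (S : almost_contact_metric M) (N : affine_connection M) : Prop :=
  levi_civita (acm_g S) N /\
  forall a x, cod a x ->
    (forall j i h, cov_t11 (N a) (acm_phi S a) x j i h = 0) /\
    (forall i h, cov_vec (N a) (acm_xi S a) x i h = 0).

(** Since eta^h = g^{hi} eta_i = xi^h, the condition D_j eta^h = 0 is written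
    with xi. *)
Definition cosymplectic_conformal (R : realType) (n : nat)
    (M : smooth_manifold R n) (S : almost_contact_metric M)
    (D : affine_connection M) : Prop :=
  exists (p : scalar_field M) (q : vector_field M),
  forall a x, cod a x ->
    [/\ forall k j i,
          cov_t02 (D a)
            (fun y => expR (2 * scalar_comp p a y) *: acm_g S a y) x k j i =
          2 * expR (2 * scalar_comp p a x) * pd (scalar_comp p a) k x
            * acm_eta S a x 0 j * acm_eta S a x 0 i,
        forall j i h, cov_t11 (D a) (acm_phi S a) x j i h = 0,
        forall j h, cov_vec (D a) (acm_xi S a) x j h = 0
      & forall j i h, D a x j i h - D a x i j h =
          - 2 * lower (acm_g S a x) (acm_phi S a x) j i * q a x 0 h].

Section Bochner.

(** Algebra at one point: [K] is the curvature of the Levi-Civita connection,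
    [xi] is also eta^h. *)
Context (R : realType) (m : nat).
Context (phi g : 'M[R]_(m.*2.+1)) (xi eta : 'rV[R]_(m.*2.+1)).
Context (K : 'I_(m.*2.+1) -> 'I_(m.*2.+1) -> 'I_(m.*2.+1) -> 'I_(m.*2.+1) -> R).

Definition ricci : 'M[R]_(m.*2.+1) := \matrix_(j, i) \sum_t K t j i t.

Definition scalar_curvature : R := \sum_j \sum_i invmx g j i * ricci j i.

Definition bochner_trace : R := - scalar_curvature / (4 * (m.+1)%:R).

Definition bochner_L : 'M[R]_(m.*2.+1) := \matrix_(j, i)
  (- (2 * (m.+2)%:R)^-1 *
     (ricci j i + bochner_trace * (g j i - eta 0 j * eta 0 i))).

Definition bochner_M : 'M[R]_(m.*2.+1) := \matrix_(j, i)
  (- \sum_t bochner_L j t * phi i t).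

Definition bochner (k j i h : 'I_(m.*2.+1)) : R :=
  let L := bochner_L in
  let L' := raise g bochner_L in
  let M := bochner_M in
  let M' := raise g bochner_M in
  let phi' := lower g phi in
  K k j i h
  + ((k == h)%:R - eta 0 k * xi 0 h) * L j i
  - ((j == h)%:R - eta 0 j * xi 0 h) * L k i
  + L' k h * (g j i - eta 0 j * eta 0 i)
  - L' j h * (g k i - eta 0 k * eta 0 i)
  + phi k h * M j i - phi j h * M k i
  + M' k h * phi' j i - M' j h * phi' k i
  - 2 * (M k j * phi i h + phi' k j * M' i h).

End Bochner.

Definition cosymplectic_bochner (R : realType) (m : nat)
    (M : smooth_manifold R m.*2) (S : almost_contact_metric M)
    (N : affine_connection M) (a : chart M) (x : 'rV[R]_(m.*2.+1))
    (k j i h : 'I_(m.*2.+1)) : R :=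
  bochner (acm_phi S a x) (acm_g S a x) (acm_xi S a x) (acm_eta S a x)
    (curvature (N a) x) k j i h.

(* Main.v *)
Require Import Defs.
From HB Require Import structures.
From mathcomp Require Import all_boot all_order all_algebra.
From mathcomp Require Import all_classical all_reals all_analysis.
From mathcomp Require Import ring lra.

Set Implicit Arguments.
Unset Strict Implicit.
Unset Printing Implicit Defensive.

Import Order.TTheory GRing.Theory Num.Theory.
Import numFieldNormedType.Exports.

Local Open Scope classical_set_scope.
Local Open Scope ring_scope.

(** Write D = nabla + A, P = 1 - eta (x) xi, gam = g - eta (x) eta, Phi for the lowered phi,
    p_i = d_i p and q_i = g_{ih} q^h.  As for the Levi-Civita connection, the metric and
    torsion conditions determine
      A_{ji}^h = p_j P_i^h + p_i P_j^h - gam_{ji} p^h + phi_j^h q_i + q_j phi_i^h - Phi_{ji} q^h;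
    D xi = 0 then makes p and q orthogonal to xi, and a trace of D phi = 0 gives
    q_i = - p_t phi_i^t.  Hence p^h = - q^t phi_t^h, so A is a polynomial in q, phi, g, xi and
    can be differentiated without differentiating the inverse metric.  When D is flat,
    K = - (nabla_k A_j - nabla_j A_k + [A, A]) is a universal expression in p, q and
    W_k^h = nabla_k q^h.  Since p_i is a gradient, nabla_k p_i is symmetric (Schwarz), and the
    cyclic sum of K reduces to the vanishing of the cyclic sum of Phi_{ji} T_k^h, where
    T = 2 (W - 2 q (x) p + |p|^2 phi).  Contracting with phi gives T = 0 in dimension 2m+1 > 3.
    What remains of K is the Bochner form built on a symmetric phi-invariant tensor, and taking
    traces identifies that tensor with - L. *)

(** * Directional derivatives and the Schwarz theorem *)

Lemma translate_quotient (R : realType) (V : normedModType R) (f : V -> R^o) (v w z : V) :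
  (fun h : R => h^-1 *: (((fun y => f (y + w)) \o shift z) (h *: v) - f (z + w))) =
  (fun h : R => h^-1 *: ((f \o shift (z + w)) (h *: v) - f (z + w))).
Proof. by apply/funext => h /=; rewrite addrA. Qed.

Lemma derive_translate (R : realType) (V : normedModType R) (f : V -> R^o) (v w z : V) :
  'D_v (fun y => f (y + w)) z = 'D_v f (z + w).
Proof. by rewrite /derive translate_quotient. Qed.

Lemma derivable_translate (R : realType) (V : normedModType R) (f : V -> R^o) (v w z : V) :
  derivable f (z + w) v -> derivable (fun y => f (y + w)) z v.
Proof. by rewrite /derivable translate_quotient. Qed.

Lemma is_derive_line (R : realType) (V : normedModType R) (f : V -> R^o) (v y : V) (s : R) :
  derivable f (y + s *: v) v ->
  is_derive s 1 (fun t : R => f (y + t *: v) : R^o) ('D_v f (y + s *: v)).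
Proof.
have E : (fun h : R => h^-1 *: (((fun t : R => f (y + t *: v) : R^o) \o shift s) (h *: 1)
            - f (y + s *: v))) =
  (fun h : R => h^-1 *: ((f \o shift (y + s *: v)) (h *: v) - f (y + s *: v))).
  apply/funext => h /=; congr (_ *: (f _ - _)).
  by rewrite [h *: 1]mulr1 scalerDl addrCA.
by move=> df; split; rewrite /derivable /derive E.
Qed.

Lemma MVT_line (R : realType) (V : normedModType R) (f : V -> R^o) (v y : V) (h : R) :
  0 < h -> (forall s, 0 <= s <= h -> derivable f (y + s *: v) v) ->
  exists2 s, 0 < s < h & f (y + h *: v) - f y = 'D_v f (y + s *: v) * h.
Proof.
move=> h0 df.
have dl s : 0 <= s <= h -> is_derive s 1 (fun t : R => f (y + t *: v) : R^o)
    ('D_v f (y + s *: v)) by move=> /df; exact: is_derive_line.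
have [||s] := @MVT R (fun t => f (y + t *: v)) (fun s => 'D_v f (y + s *: v)) 0 h h0.
- by move=> s; rewrite in_itv /= => /andP[s0 sh]; apply: dl; rewrite !ltW.
- apply: derivable_within_continuous => s; rewrite in_itv /= => sh.
  by have [] := dl s sh.
rewrite in_itv /= => sh; rewrite scale0r addr0 subr0 => E.
by exists s.
Qed.

Lemma nbhs_ball_sub (R : realType) (n : nat) (U : set 'rV[R]_n.+1) x :
  open U -> U x -> exists2 e, 0 < e & forall y : 'rV[R]_n.+1, `|y - x| < e -> U y.
Proof.
move=> oU Ux; have /nbhs_ballP[e /= e0 sub] := open_nbhs_nbhs (conj oU Ux).
exists e => // y yx; apply: sub; rewrite -ball_normE /= distrC; exact: yx.
Qed.

Lemma norm_delta_mx_le1 (R : realType) (n : nat) (i : 'I_n.+1) :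
  `|delta_mx 0 i : 'rV[R]_n.+1| <= 1.
Proof.
rewrite /Num.norm /= mx_normrE; apply/bigmax_leP; split => // -[a b] _.
by rewrite mxE; case: (_ && _); rewrite ?normr1 ?normr0 ?ler01.
Qed.

(** Serves the Schwarz theorem, where [a] and [b] are the two mixed derivatives at a point and [c]
    is the value that a single second difference gives to both at nearby points. *)
Lemma eq_common_approx (R : realFieldType) (a b : R) :
  (forall e, 0 < e -> exists2 c, `|a - c| < e & `|b - c| < e) -> a = b.
Proof.
move=> approx; apply/eqP; rewrite -subr_eq0 -normr_eq0; apply/eqP.
apply/le_anti/andP; split => //; apply/ler_addgt0Pr => e e0; rewrite add0r.
have [c ac bc] := approx _ (divr_gt0 e0 (ltr0n R 2)).
rewrite ltW // [e]splitr; apply: le_lt_trans (ltrD ac bc).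
by rewrite (distrC b); exact: ler_distD.
Qed.

Section Schwarz.
Context (R : realType) (n : nat).
Implicit Types (U : set 'rV[R]_n.+1) (f : 'rV[R]_n.+1 -> R).

Let E (i : 'I_n.+1) : 'rV[R]_n.+1 := delta_mx 0 i.

Lemma norm_square_le (i j : 'I_n.+1) (s t h : R) :
  0 <= s <= h -> 0 <= t <= h -> `|s *: E i + t *: E j| <= h + h.
Proof.
move=> /andP[s0 sh] /andP[t0 th]; apply: (le_trans (ler_normD _ _)).
rewrite !normrZ (ger0_norm s0) (ger0_norm t0).
by apply: lerD; [apply: le_trans sh|apply: le_trans th]; rewrite -[leRHS]mulr1;
  apply: ler_wpM2l => //; exact: norm_delta_mx_le1.
Qed.

(** The mean value theorem is applied twice: along [E i] to the increment [d] of [f] in the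
    direction [E j], then along [E j] to [pd f i]. The intermediate point lies in the square of side
    [h] at [x], whence the bound [h + h]. *)
Lemma second_difference U f (i j : 'I_n.+1) x (h : R) : Ck 2 U f -> 0 < h ->
  (forall y : 'rV[R]_n.+1, `|y - x| <= h + h -> U y) ->
  exists2 y : 'rV[R]_n.+1, `|y - x| <= h + h &
    f (x + h *: E i + h *: E j) - f (x + h *: E i) - f (x + h *: E j) + f x
      = pd (pd f i) j y * h * h.
Proof.
move=> [_ [df /(_ i)[_ [dfi _]]]] h0 sub.
have hh : 0 <= h <= h by rewrite lexx ltW.
have h00 : 0 <= (0 : R) <= h by rewrite lexx ltW.
have inU s t : 0 <= s <= h -> 0 <= t <= h -> U (x + s *: E i + t *: E j).
  by move=> hs ht; apply: sub; rewrite addrC !addrA addNr add0r; exact: norm_square_le.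
have inU0 s : 0 <= s <= h -> U (x + s *: E i).
  by move=> hs; have := inU s 0 hs h00; rewrite scale0r addr0.
pose d : 'rV[R]_n.+1 -> R^o := (fun y => f (y + h *: E j) : R^o) - (f : _ -> R^o).
have [s hs|s /andP[s0 sh] Es] := @MVT_line R _ d (E i) x h h0.
  apply: derivableB; last exact/df/inU0.
  by apply: derivable_translate; exact/df/inU.
have hs : 0 <= s <= h by rewrite !ltW.
have [t ht|t /andP[t0 th] Et] := @MVT_line R _ (pd f i) (E j) (x + s *: E i) h h0.
  exact/dfi/inU.
have ht : 0 <= t <= h by rewrite !ltW.
exists (x + s *: E i + t *: E j).
  by rewrite addrC !addrA addNr add0r; exact: norm_square_le.
rewrite (_ : _ + f x = d (x + h *: E i) - d x); last first.
  by rewrite /d /= !fctE opprB addrA addrAC.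
have -> : pd (pd f i) j (x + s *: E i + t *: E j) * h =
    pd f i (x + s *: E i + h *: E j) - pd f i (x + s *: E i) by rewrite -Et.
rewrite Es; congr (_ * _); rewrite deriveB.
- by rewrite derive_translate.
- by apply: derivable_translate; exact/df/inU.
- exact/df/inU0.
Qed.

Lemma pd_comm U f (i j : 'I_n.+1) x : open U -> Ck 2 U f -> U x ->
  pd (pd f i) j x = pd (pd f j) i x.
Proof.
move=> oU C2 Ux; apply: eq_common_approx => e e0.
have cont a b : {for x, continuous (pd (pd f a) b)}.
  by have [_ [_ /(_ a)[_ [_ /(_ b)[/(_ x Ux)]]]]] := C2.
have close a b : exists2 r, 0 < r & forall y : 'rV[R]_n.+1, `|y - x| < r ->
    `|pd (pd f a) b x - pd (pd f a) b y| < e.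
  have /cvgrPdist_lt /(_ _ e0) /nbhs_ballP[r /= r0 sub] := cont a b.
  by exists r => // y yx; apply: sub; rewrite -ball_normE /= distrC.
have [r r0 subU] := nbhs_ball_sub oU Ux.
have [r1 r10 sub1] := close i j.
have [r2 r20 sub2] := close j i.
(* The quarter makes [h + h] strictly smaller than each radius, so the whole square lies in [U] and
   in both balls of continuity. *)
pose h := Num.min r (Num.min r1 r2) / 4.
have h0 : 0 < h by rewrite divr_gt0// !lt_min r0 r10 r20.
have hh : h + h < Num.min r (Num.min r1 r2).
  rewrite /h; set c := Num.min _ _; have : 0 < c by rewrite !lt_min r0 r10 r20.
  lra.
move: hh; rewrite !lt_min => /and3P[hr hr1 hr2].
have sub y : `|y - x| <= h + h -> U y by move=> /le_lt_trans /(_ hr) /subU.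
have [y yx Ey] := second_difference i j C2 h0 sub.
have [z zx Ez] := second_difference j i C2 h0 sub.
exists (pd (pd f i) j y); first exact: sub1 (le_lt_trans yx hr1).
(* The second difference is symmetric in [i] and [j]; both expressions for it carry the factor
   [h * h], which is cancelled. *)
have -> : pd (pd f i) j y = pd (pd f j) i z.
  apply: (mulIf (lt0r_neq0 h0)); apply: (mulIf (lt0r_neq0 h0)).
  apply: etrans (etrans (esym Ey) _) Ez.
  by rewrite (addrAC x (h *: E j)) (addrAC (f (x + h *: E i + h *: E j))).
exact: sub2 (le_lt_trans zx hr2).
Qed.

End Schwarz.

(** * Algebra of an almost contact metric structure at a point *)

(* Unlike [mxE] these do not unfold products of matrices. *)
Lemma mx_addE (R : nzRingType) a b (X Y : 'M[R]_(a, b)) i j : (X + Y) i j = X i j + Y i j.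
Proof. by rewrite mxE. Qed.

Lemma mx_oppE (R : nzRingType) a b (X : 'M[R]_(a, b)) i j : (- X) i j = - X i j.
Proof. by rewrite mxE. Qed.

Lemma mx_scaleE (R : nzRingType) a b c (X : 'M[R]_(a, b)) i j : (c *: X) i j = c * X i j.
Proof. by rewrite mxE. Qed.

Definition bil (R : realFieldType) (n : nat) (G : 'M[R]_n) (u v : 'rV[R]_n) : R :=
  (u *m G *m v^T) 0 0.

(** The pairing of a vector with a covector, both stored as rows; no metric enters. *)
Definition dot (R : realFieldType) (n : nat) (u v : 'rV[R]_n) : R := (u *m v^T) 0 0.

Section Dot.
Context (R : realFieldType) (n : nat).
Implicit Types (G X : 'M[R]_n) (u v w : 'rV[R]_n).

Lemma mul_11mx k (c : 'M[R]_1) (X : 'M[R]_(1, k)) : c *m X = c 0 0 *: X.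
Proof. by rewrite {1}[c]mx11_scalar mul_scalar_mx. Qed.

Lemma bilE G u v : bil G u v = dot (u *m G) v. Proof. by []. Qed.
Lemma dotC u v : dot u v = dot v u.
Proof. by rewrite /dot -[v *m _]trmxK trmx_mul trmxK [in RHS]mxE. Qed.
Lemma dotDl u v w : dot (u + v) w = dot u w + dot v w.
Proof. by rewrite /dot mulmxDl mxE. Qed.
Lemma dotNl u w : dot (- u) w = - dot u w.
Proof. by rewrite /dot mulNmx mxE. Qed.
Lemma dotZl c u w : dot (c *: u) w = c * dot u w.
Proof. by rewrite /dot -scalemxAl mxE. Qed.
Lemma dot0l w : dot 0 w = 0.
Proof. by rewrite /dot mul0mx mxE. Qed.
Lemma dotMl u X w : dot (u *m X) w = dot u (w *m X^T).
Proof. by rewrite /dot trmx_mul trmxK mulmxA. Qed.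
Lemma dotDr u v w : dot w (u + v) = dot w u + dot w v.
Proof. by rewrite !(dotC w) dotDl. Qed.
Lemma dotNr u w : dot w (- u) = - dot w u.
Proof. by rewrite !(dotC w) dotNl. Qed.
Lemma dotZr c u w : dot w (c *: u) = c * dot w u.
Proof. by rewrite !(dotC w) dotZl. Qed.
Lemma bilDr G u v w : bil G w (u + v) = bil G w u + bil G w v.
Proof. exact: dotDr. Qed.
Lemma bilNr G u w : bil G w (- u) = - bil G w u.
Proof. exact: dotNr. Qed.
Lemma bilZr G c u w : bil G w (c *: u) = c * bil G w u.
Proof. exact: dotZr. Qed.
Lemma bil_tr G u v : bil G u v = bil G^T v u.
Proof. by rewrite !bilE dotMl dotC. Qed.
Lemma dot_delta u i : dot (delta_mx 0 i) u = u 0 i.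
Proof. by rewrite /dot -rowE !mxE. Qed.
Lemma bil_delta G i j : bil G (delta_mx 0 i) (delta_mx 0 j) = G i j.
Proof. by rewrite bilE dotC dot_delta -rowE mxE. Qed.
Lemma mul_dot u v k (X : 'rV[R]_k) : u *m (v^T *m X) = dot u v *: X.
Proof. by rewrite mulmxA mul_11mx. Qed.
Lemma tr_dot u v : \tr (v^T *m u) = dot u v.
Proof. by rewrite mxtrace_mulC /mxtrace big_ord1. Qed.

Lemma bil_add G X u v : bil (G + X) u v = bil G u v + bil X u v.
Proof. by rewrite !bilE mulmxDr dotDl. Qed.
Lemma bil_opp G u v : bil (- G) u v = - bil G u v.
Proof. by rewrite !bilE mulmxN dotNl. Qed.
Lemma bil_scale (c : R) G u v : bil (c *: G) u v = c * bil G u v.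
Proof. by rewrite !bilE -scalemxAr dotZl. Qed.
Lemma bil_outer (a b u v : 'rV[R]_n) : bil (a^T *m b) u v = dot u a * dot v b.
Proof. by rewrite bilE mul_dot dotZl (dotC b). Qed.

Lemma mxtrD (X Y : 'M[R]_n) : \tr (X + Y) = \tr X + \tr Y.
Proof. exact: mxtraceD. Qed.
Lemma mxtrB (X Y : 'M[R]_n) : \tr (X - Y) = \tr X - \tr Y.
Proof. exact: raddfB. Qed.
Lemma mxtrZ c (X : 'M[R]_n) : \tr (c *: X) = c * \tr X.
Proof. exact: mxtraceZ. Qed.

End Dot.

(** Vectors are rows, so phi acts on them as [u *m F] and on covectors through [F^T]; lowering an
    index is multiplication by [g] on the right. *)
Record contact_metric (R : realFieldType) (n : nat) (F g : 'M[R]_n) (xi eta : 'rV[R]_n) :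
    Prop := ContactMetric {
  cm_FF : F *m F = eta^T *m xi - 1%:M;
  cm_xiF : xi *m F = 0;
  cm_Feta : F *m eta^T = 0;
  cm_xieta : dot xi eta = 1;
  cm_FgF : F *m g *m F^T = g - eta^T *m eta;
  cm_eta : eta = xi *m g;
  cm_gT : g^T = g;
  cm_g : g \in unitmx
}.

(* [P], [gam] and [Phi] are variables with defining equations, so that rewriting never
   unfolds them. *)
Section Pointwise.
Context (R : realFieldType) (n : nat).
Context (F g : 'M[R]_n) (xi eta : 'rV[R]_n).
Hypothesis cm : contact_metric F g xi eta.

Context (P gam Phi : 'M[R]_n).
Hypothesis PE : P = 1%:M - eta^T *m xi.
Hypothesis gamE : gam = g - eta^T *m eta.
Hypothesis PhiE : Phi = F *m g.

Lemma contact_FF : F *m F = - P.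
Proof. by rewrite (cm_FF cm) PE opprB. Qed.

Lemma contact_xi_etaT : xi *m eta^T = 1%:M.
Proof. by rewrite [LHS]mx11_scalar [X in X%:M](cm_xieta cm). Qed.

Lemma contact_xiP : xi *m P = 0.
Proof. by rewrite PE mulmxBr mulmx1 mulmxA contact_xi_etaT mul1mx subrr. Qed.

Lemma contact_Peta : P *m eta^T = 0.
Proof. by rewrite PE mulmxBl mul1mx -mulmxA contact_xi_etaT mulmx1 subrr. Qed.

Lemma contact_PF : P *m F = F.
Proof. by rewrite PE mulmxBl mul1mx -mulmxA (cm_xiF cm) mulmx0 subr0. Qed.

Lemma contact_FP : F *m P = F.
Proof. by rewrite PE mulmxBr mulmx1 mulmxA (cm_Feta cm) mul0mx subr0. Qed.

Lemma contact_PP : P *m P = P.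
Proof. by rewrite {2}PE mulmxBr mulmx1 mulmxA contact_Peta mul0mx subr0. Qed.

Lemma contact_Pg : P *m g = gam.
Proof. by rewrite PE mulmxBl mul1mx -mulmxA -(cm_eta cm). Qed.

Lemma contact_gamT : gam^T = gam.
Proof. by rewrite gamE linearB /= (cm_gT cm) trmx_mul trmxK. Qed.

Lemma contact_gPT : g *m P^T = gam.
Proof. by rewrite -{1}(cm_gT cm) -trmx_mul contact_Pg contact_gamT. Qed.

(** Skewness of the lowered phi comes from multiplying the compatibility of [g] and [F] by [F^T]:
    the square of [F^T] is [- P^T], and the eta term is killed. *)
Lemma contact_gFT : g *m F^T = - Phi.
Proof.
rewrite PhiE.
have /(congr1 (fun X => X *m F^T)) := cm_FgF cm.
rewrite -!mulmxA -trmx_mul contact_FF linearN /= -[in RHS](trmxK eta).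
rewrite mulmxBl -mulmxA -trmx_mul.
rewrite trmxK (cm_Feta cm) trmx0 mulmx0 subr0 => <-.
by rewrite mulmxN contact_gPT mulmxN -contact_Pg mulmxA contact_FP.
Qed.

Lemma contact_PhiT : Phi^T = - Phi.
Proof. by rewrite {1}PhiE trmx_mul (cm_gT cm) contact_gFT. Qed.

Lemma contact_PhiF : Phi *m F^T = gam.
Proof. by rewrite PhiE gamE; exact: (cm_FgF cm). Qed.

Lemma contact_trP : \tr P = n%:R - 1.
Proof. by rewrite PE linearB /= mxtrace1 tr_dot (cm_xieta cm). Qed.

Lemma contact_ginvF : invmx g *m F = - (F^T *m invmx g).
Proof.
apply: (can_inj (mulKmx (cm_g cm))); apply: (can_inj (mulmxK (cm_g cm))).
by rewrite mulKVmx ?(cm_g cm)// mulmxN mulmxA contact_gFT !mulNmx opprK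
  mulmxKV ?(cm_g cm).
Qed.

(** Since phi is skew for the metric, [F] is conjugate by [g] to [- F^T]. *)
Lemma contact_trF : \tr F = 0.
Proof.
have : \tr F = - \tr F; last by lra.
rewrite -{1}(mulmxK (cm_g cm) F) -PhiE -(opprK Phi) -contact_gFT mulNmx.
by rewrite linearN /= mxtrace_mulC mulmxA mulVmx ?(cm_g cm)// mul1mx mxtrace_tr.
Qed.

(** The trace isolates [c] because [F] is traceless; multiplying the relation by [F] exchanges the
    roles of [P] and [F], and the same argument isolates [d]. *)
Lemma contact_tr_horizontal (c d : R) : n%:R - 1 != 0 :> R ->
  c *: P + d *: F = 0 -> c = 0 /\ d = 0.
Proof.
move=> n1 E; have tr0 c' d' : c' *: P + d' *: F = 0 -> c' = 0.
  move/(congr1 mxtrace); rewrite linearD !linearZ /= contact_trP contact_trF.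
  by rewrite mulr0 addr0 mxtrace0 => /eqP; rewrite mulf_eq0 (negbTE n1) orbF => /eqP.
split; first exact: (tr0 c d).
apply: oppr_inj; rewrite oppr0; apply: (tr0 _ c).
by rewrite scaleNr -scalerN -contact_FF scalemxAl -[X in _ + c *: X]contact_PF
  scalemxAl -mulmxDl addrC E mul0mx.
Qed.

(* [pv], [ps], [ql], [q] are p_i, p^h, q_i, q^h. *)
Section Potential.
Context (pv ps ql q : 'rV[R]_n).
Hypothesis ps_g : ps *m g = pv.
Hypothesis q_g : q *m g = ql.

(* The matrix, in the indices (i, h), of u^j A_{ji}^h. *)
Definition conf_op (u : 'rV[R]_n) : 'M[R]_n :=
  dot u pv *: P + pv^T *m (u *m P) - (u *m gam)^T *m ps
  + ql^T *m (u *m F) + dot u ql *: F - (u *m Phi)^T *m q.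

Definition conf_bil (u v : 'rV[R]_n) : 'rV[R]_n :=
  dot u pv *: (v *m P) + dot v pv *: (u *m P) - bil gam u v *: ps
  + dot v ql *: (u *m F) + dot u ql *: (v *m F) - bil Phi u v *: q.

Lemma mul_conf_op u v : v *m conf_op u = conf_bil u v.
Proof.
rewrite /conf_op /conf_bil !(mulmxBr, mulmxDr) -!scalemxAr !mul_dot.
by rewrite !bilE !(dotC v).
Qed.

(** * The difference tensor A determined by the metric, torsion, phi and xi conditions *)

Section Determination.
Context (A : 'I_n -> 'M[R]_n).
Hypothesis A_metric : forall k, A k *m g + g *m (A k)^T = 2 * pv 0 k *: gam.
Hypothesis A_torsion : forall k j h, A k j h - A j k h = - 2 * Phi k j * q 0 h.
Hypothesis A_F : forall k, F *m A k = A k *m F.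
Hypothesis A_xi : forall k, xi *m A k = 0.
Hypothesis n1 : n%:R - 1 != 0 :> R.
Hypothesis n3 : n%:R - 3 != 0 :> R.

(* The Koszul argument: A_{kji} + A_{kij} and A_{kji} - A_{jki} are both prescribed. *)
Lemma conf_op_lower k : A k *m g =
  pv 0 k *: gam + pv^T *m row k gam - (row k gam)^T *m pv
  + ql^T *m row k Phi + ql 0 k *: Phi - (row k Phi)^T *m ql.
Proof.
pose a k j i := (A k *m g) j i.
have gamC i j : gam i j = gam j i by rewrite -[in LHS]contact_gamT mxE.
have PhiC i j : Phi i j = - Phi j i by rewrite -[Phi in LHS]trmxK contact_PhiT !mxE.
have m1 k' j i : a k' j i + a k' i j = 2 * pv 0 k' * gam j i.
  have /matrixP/(_ j i) := A_metric k'.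
  rewrite -[X in _ + X]trmxK trmx_mul trmxK (cm_gT cm).
  by rewrite mxE [X in _ + X]mxE [in RHS]mxE.
have m2 k' j i : a k' j i - a j k' i = - 2 * Phi k' j * ql 0 i.
  rewrite /a -q_g !mxE -sumrB mulr_sumr; apply: eq_bigr => t _.
  by rewrite -mulrBl A_torsion !mulrA.
apply/matrixP => j i; rewrite -/(a k j i).
rewrite !mxE !big_ord1 !mxE.
have := m1 k j i; have := m1 i k j; have := m1 j i k.
have := m2 k j i; have := m2 i k j; have := m2 j i k.
rewrite ?(gamC i k) ?(gamC i j) ?(gamC j k) ?(PhiC i k) ?(PhiC j k) ?(PhiC i j).
lra.
Qed.

Lemma conf_op_unique k : A k = conf_op (delta_mx 0 k).
Proof.
apply: (can_inj (mulmxK (cm_g cm))); rewrite conf_op_lower /conf_op.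
rewrite !(mulmxBl, mulmxDl) -!scalemxAl -!mulmxA ps_g contact_Pg -PhiE q_g.
by rewrite !dot_delta -!rowE.
Qed.

(** In xi^i A_{ki}^h every term in which xi meets [P], [F], [gam] or [Phi] vanishes; what survives
    is a combination of [P] and [F] whose coefficients are the two pairings. *)
Lemma pv_xi_ql_xi : dot xi pv = 0 /\ dot xi ql = 0.
Proof.
apply: contact_tr_horizontal => //; apply/row_matrixP => k.
rewrite rowE mulmxDr -!scalemxAr row0 -[RHS](A_xi k) conf_op_unique mul_conf_op.
rewrite /conf_bil contact_xiP (cm_xiF cm) !scaler0 add0r addr0.
have -> : bil gam (delta_mx 0 k) xi = 0.
  by rewrite bil_tr contact_gamT bilE -contact_Pg mulmxA contact_xiP mul0mx dot0l.
have -> : bil Phi (delta_mx 0 k) xi = 0.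
  by rewrite bil_tr contact_PhiT PhiE bilE mulmxN mulmxA (cm_xiF cm) mul0mx oppr0 dot0l.
by rewrite !scale0r !subr0.
Qed.

Lemma ps_F : ps *m F *m g = - (pv *m F^T).
Proof.
by rewrite -mulmxA -PhiE -[Phi]opprK -contact_gFT mulmxN mulmxA ps_g.
Qed.

Lemma ql_pv : ql = - (pv *m F^T).
Proof.
have [pxi qxi] := pv_xi_ql_xi.
apply/eqP; rewrite -addr_eq0; apply/eqP/rowP => i; rewrite -dot_delta [RHS]mxE.
set v := delta_mx 0 i; set w := dot _ _.
have psq : dot (v *m F) pv = dot v (pv *m F^T) by exact: dotMl.
(* The matrix [E] is the condition on [A_F] contracted with [v] in one lower index; its trace
   is [(n - 3) w]. *)
have E : w *: P + (dot (v *m F) ql - dot v pv) *: F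
    - (gam *m (v *m F)^T *m ps - gam *m v^T *m (ps *m F))
    - (Phi *m (v *m F)^T *m q - Phi *m v^T *m (q *m F)) = 0.
  apply/row_matrixP => k; rewrite row0 rowE.
  have /(congr1 (fun X => v *m X)) := A_F k.
  rewrite !mulmxA conf_op_unique !mul_conf_op /conf_bil.
  rewrite !(mulmxBl, mulmxDl) -!scalemxAl -!mulmxA.
  rewrite contact_FP contact_PF !contact_FF.
  rewrite !(mulmxBr, mulmxDr) -!scalemxAr.
  rewrite (mulmxA _ gam) (mulmxA _ Phi) (mulmxA _ gam) (mulmxA _ Phi).
  rewrite !mulmxN !scalerN.
  rewrite !mulmxA !mul_11mx.
  rewrite -![(_ *m (_)^T) 0 0]/(bil _ _ _) -!scalemxAl /w dotDr -psq.
  move=> /eqP; rewrite -subr_eq0 => /eqP Z.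
  apply/eqP; rewrite -{}Z; apply/eqP.
  set k' := delta_mx 0 k.
  move: (k' *m P) (k' *m F) (v *m F) (v *m P) (ps *m F) (q *m F) => kP kF vF vP psF qF.
  apply/rowP => h; rewrite !mxE; ring.
(* By cyclicity the outer products become pairings. The [gam] terms give twice [dot v (pv *m F^T)]
   and the [Phi] terms twice [dot v ql], both subtracted, which lowers n - 1 to n - 3. *)
have := congr1 mxtrace E.
rewrite !mxtrB mxtrD !mxtrZ contact_trP contact_trF mxtrace0.
rewrite -!mulmxA !(mxtrace_mulC _ (_ *m _)) -!mulmxA !tr_dot mulr0 addr0.
have -> : dot (ps *m gam) (v *m F) = dot v (pv *m F^T).
  rewrite dotC dotMl -mulmxA -contact_Pg -mulmxA contact_gFT PhiE.
  by rewrite !mulmxN (mulmxA P) contact_PF (mulmxA ps) ps_F opprK.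
have -> : dot (ps *m (F *m gam)) v = - dot v (pv *m F^T).
  by rewrite dotC -contact_Pg !mulmxA -(mulmxA ps) contact_FP ps_F dotNr.
(* As q is orthogonal to xi, [gam] lowers its index exactly as [g] does. *)
have qgam : q *m gam = ql.
  rewrite gamE mulmxBr q_g mulmxA mul_11mx -[(_ *m _^T) 0 0]/(dot q eta).
  by rewrite (cm_eta cm) -{1}(cm_gT cm) -dotMl q_g dotC qxi scale0r subr0.
have -> : dot (q *m Phi) (v *m F) = dot v ql.
  by rewrite dotC dotMl -mulmxA contact_PhiF qgam.
have -> : dot (q *m (F *m Phi)) v = - dot v ql.
  by rewrite PhiE (mulmxA F) contact_FF mulNmx contact_Pg mulmxN qgam dotNl dotC.
rewrite /w dotDr => W; apply: (mulfI n3); rewrite mulr0 -{}W; ring.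
Qed.

End Determination.
(* The rows of [W] are nabla_k q^h. *)
Section Curvature.
Hypothesis q_F : q *m F = - ps.
Hypothesis q_P : q *m P = q.
Context (W : 'M[R]_n).
Hypothesis W_P : W *m P = W.

(* [lam] is |p|^2; [Wl] and [S] are nabla_k q_i and nabla_k p_i. *)
Context (lam : R) (Wl S : 'M[R]_n).
Hypothesis lamE : dot ps pv = lam.
Hypothesis WlE : Wl = W *m g.
Hypothesis SE : S = Wl *m F^T.

(** * Pairings of p and q with each other and with the structure tensors *)

Lemma ps_P : ps *m P = ps.
Proof. by rewrite -[ps]opprK -q_F mulNmx -mulmxA contact_FP. Qed.

Lemma psF : ps *m F = q.
Proof. by rewrite -[ps]opprK -q_F mulNmx -mulmxA contact_FF mulmxN opprK. Qed.

Lemma pv_PT : pv *m P^T = pv.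
Proof. by rewrite -{1}ps_g -mulmxA contact_gPT -contact_Pg mulmxA ps_P. Qed.

Lemma ql_PT : ql *m P^T = ql.
Proof. by rewrite -{1}q_g -mulmxA contact_gPT -contact_Pg mulmxA q_P. Qed.

Lemma pv_FT : pv *m F^T = - ql.
Proof. by rewrite -ps_g -mulmxA contact_gFT PhiE mulmxN mulmxA psF q_g. Qed.

Lemma ql_FT : ql *m F^T = pv.
Proof. by rewrite -q_g -mulmxA contact_gFT PhiE mulmxN mulmxA q_F mulNmx opprK. Qed.

Lemma dot_P_pv u : dot (u *m P) pv = dot u pv.
Proof. by rewrite dotMl pv_PT. Qed.
Lemma dot_P_ql u : dot (u *m P) ql = dot u ql.
Proof. by rewrite dotMl ql_PT. Qed.
Lemma dot_F_pv u : dot (u *m F) pv = - dot u ql.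
Proof. by rewrite dotMl pv_FT dotNr. Qed.
Lemma dot_F_ql u : dot (u *m F) ql = dot u pv.
Proof. by rewrite dotMl ql_FT. Qed.
Lemma dot_q_pv : dot q pv = 0.
Proof.
have : dot q pv = - dot q pv; last by lra.
by rewrite -{1}psF dot_F_pv -q_g dotC dotMl (cm_gT cm) ps_g.
Qed.
Lemma dot_ps_ql : dot ps ql = 0.
Proof. by rewrite -[LHS]opprK -dot_F_pv psF dot_q_pv oppr0. Qed.
Lemma dot_q_ql : dot q ql = lam.
Proof. by rewrite -psF dot_F_ql lamE. Qed.

Lemma bil_gam_P u v : bil gam u (v *m P) = bil gam u v.
Proof.
rewrite !bilE dotC dotMl dotC -mulmxA -contact_Pg -mulmxA contact_gPT -contact_Pg.
by rewrite [P *m (_ *m _)]mulmxA contact_PP.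
Qed.
Lemma bil_gam_F u v : bil gam u (v *m F) = - bil Phi u v.
Proof.
rewrite !bilE dotC dotMl dotC -mulmxA -contact_Pg -mulmxA contact_gFT.
by rewrite !mulmxN PhiE [P *m (_ *m _)]mulmxA contact_PF dotNl.
Qed.
Lemma bil_Phi_P u v : bil Phi u (v *m P) = bil Phi u v.
Proof.
rewrite !bilE dotC dotMl dotC -mulmxA PhiE -(mulmxA F) contact_gPT -contact_Pg.
by rewrite [F *m (_ *m _)]mulmxA contact_FP.
Qed.
Lemma bil_Phi_F u v : bil Phi u (v *m F) = bil gam u v.
Proof. by rewrite !bilE dotC dotMl dotC -mulmxA contact_PhiF. Qed.
Lemma bil_gam_ps u : bil gam u ps = dot u pv.
Proof. by rewrite bilE dotMl contact_gamT -contact_Pg mulmxA ps_P ps_g. Qed.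
Lemma bil_gam_q u : bil gam u q = dot u ql.
Proof. by rewrite bilE dotMl contact_gamT -contact_Pg mulmxA q_P q_g. Qed.
Lemma bil_Phi_ps u : bil Phi u ps = - dot u ql.
Proof. by rewrite bilE dotMl contact_PhiT mulmxN PhiE mulmxA psF q_g dotNr. Qed.
Lemma bil_Phi_q u : bil Phi u q = dot u pv.
Proof. by rewrite bilE dotMl contact_PhiT mulmxN PhiE mulmxA q_F mulNmx opprK ps_g. Qed.
Lemma bil_gamC u v : bil gam u v = bil gam v u.
Proof. by rewrite bil_tr contact_gamT. Qed.
Lemma bil_PhiC u v : bil Phi u v = - bil Phi v u.
Proof. by rewrite bil_tr contact_PhiT bilE mulmxN dotNl. Qed.

(* u^k v^j w^i nabla_k A_{ji}^h. *)
Definition cov_bil u v w : 'rV[R]_n :=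
  bil S u v *: (w *m P) + bil S u w *: (v *m P) + bil gam v w *: (u *m W *m F)
  + bil Wl u w *: (v *m F) + bil Wl u v *: (w *m F) - bil Phi v w *: (u *m W).

(* [pm] and [qm] will be - L and - M; [pmr] and [qmr] have their second index raised. *)
Context (pm qm pmr qmr : 'M[R]_n).
Hypothesis pmE : pm = S - pv^T *m pv + ql^T *m ql + (lam / 2) *: gam.
Hypothesis qmE : qm = Wl - pv^T *m ql - ql^T *m pv + (lam / 2) *: Phi.
Hypothesis pmrE : pmr = - (W *m F) - pv^T *m ps + ql^T *m q + (lam / 2) *: P.
Hypothesis qmrE : qmr = W - pv^T *m q - ql^T *m ps + (lam / 2) *: F.

(** [conf_bil u] depends on its second argument [x] only through two pairings, two bilinear forms
    and the images of [x] under [P] and [F]; these six quantities are computed one by one. *)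
Lemma conf_bil_comp u v w : conf_bil u (conf_bil v w) =
  dot u pv *: (dot v pv *: (w *m P) + dot w pv *: (v *m P) - bil gam v w *: ps
    + dot w ql *: (v *m F) + dot v ql *: (w *m F) - bil Phi v w *: q)
  + (2 * (dot v pv * dot w pv - dot w ql * dot v ql) - lam * bil gam v w) *: (u *m P)
  - (dot v pv * bil gam u w + dot w pv * bil gam u v - bil gam v w * dot u pv
     - dot w ql * bil Phi u v - dot v ql * bil Phi u w - bil Phi v w * dot u ql) *: ps
  + (2 * (dot v pv * dot w ql + dot w pv * dot v ql) - lam * bil Phi v w) *: (u *m F)
  + dot u ql *: (dot v pv *: (w *m F) + dot w pv *: (v *m F) - bil gam v w *: q
    - dot w ql *: (v *m P) - dot v ql *: (w *m P) + bil Phi v w *: ps)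
  - (dot v pv * bil Phi u w + dot w pv * bil Phi u v + bil gam v w * dot u ql
     + dot w ql * bil gam u v + dot v ql * bil gam u w - bil Phi v w * dot u pv) *: q.
Proof.
rewrite {1}/conf_bil; set x := conf_bil v w.
have -> : dot x pv = 2 * (dot v pv * dot w pv - dot w ql * dot v ql) - lam * bil gam v w.
  rewrite /x /conf_bil !(dotDl, dotNl, dotZl) !(dot_P_pv, dot_F_pv) dot_q_pv lamE; ring.
have -> : dot x ql = 2 * (dot v pv * dot w ql + dot w pv * dot v ql) - lam * bil Phi v w.
  rewrite /x /conf_bil !(dotDl, dotNl, dotZl) !(dot_P_ql, dot_F_ql) dot_ps_ql dot_q_ql; ring.
have -> : bil gam u x = dot v pv * bil gam u w + dot w pv * bil gam u v - bil gam v w * dot u pv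
     - dot w ql * bil Phi u v - dot v ql * bil Phi u w - bil Phi v w * dot u ql.
  rewrite /x /conf_bil !(bilDr, bilNr, bilZr) !(bil_gam_P, bil_gam_F) bil_gam_ps bil_gam_q; ring.
have -> : bil Phi u x = dot v pv * bil Phi u w + dot w pv * bil Phi u v + bil gam v w * dot u ql
     + dot w ql * bil gam u v + dot v ql * bil gam u w - bil Phi v w * dot u pv.
  rewrite /x /conf_bil !(bilDr, bilNr, bilZr) !(bil_Phi_P, bil_Phi_F) bil_Phi_ps bil_Phi_q; ring.
have -> : x *m P = x.
  rewrite /x /conf_bil !(mulmxDl, mulNmx) -!scalemxAl -!mulmxA.
  by rewrite contact_PP contact_FP ps_P q_P.
have -> // : x *m F = dot v pv *: (w *m F) + dot w pv *: (v *m F) - bil gam v w *: q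
    - dot w ql *: (v *m P) - dot v ql *: (w *m P) + bil Phi v w *: ps.
rewrite /x /conf_bil !(mulmxDl, mulNmx) -!scalemxAl -!mulmxA.
by rewrite contact_PF contact_FF psF q_F !mulmxN !scalerN !opprK.
Qed.

(** The quadratic terms in [lam] are shared equally between the two members of each pair, such as
    [pm] with [P] and [gam] with [pmr], whence the halves in their definitions. The last three terms
    are the obstruction to the Bochner form. *)
Lemma conf_curvature u v w :
  - (cov_bil u v w - cov_bil v u w
     + conf_bil u (conf_bil v w) - conf_bil v (conf_bil u w)) =
  bil pm v w *: (u *m P) - bil pm u w *: (v *m P)
  + bil gam v w *: (u *m pmr) - bil gam u w *: (v *m pmr)
  + bil qm v w *: (u *m F) - bil qm u w *: (v *m F)
  + bil Phi v w *: (u *m qmr) - bil Phi u w *: (v *m qmr)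
  + (bil qm v u - bil qm u v + lam * bil Phi u v) *: (w *m F)
  + (2 * bil Phi u v) *: (dot w pv *: q - dot w ql *: ps)
  - (bil S u v - bil S v u) *: (w *m P).
Proof.
rewrite !conf_bil_comp /cov_bil pmE qmE.
rewrite !(bil_add, bil_opp, bil_scale, bil_outer).
have pmrx x : x *m pmr = - (x *m W *m F) - dot x pv *: ps + dot x ql *: q + (lam / 2) *: (x *m P).
  by rewrite pmrE !mulmxDr !mulmxN !mul_dot -scalemxAr !mulmxA.
have qmrx x : x *m qmr = x *m W - dot x pv *: q - dot x ql *: ps + (lam / 2) *: (x *m F).
  by rewrite qmrE !mulmxDr !mulmxN !mul_dot -scalemxAr.
rewrite !pmrx !qmrx (bil_gamC v u) (bil_PhiC v u).
move: (u *m W *m F) (v *m W *m F) (u *m W) (v *m W) (u *m P) (v *m P) (w *m P)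
  (u *m F) (v *m F) (w *m F).
move=> uWF vWF uW vW uP vP wP uF vF wF.
apply/rowP => h; by rewrite !mxE; field.
Qed.

(** The curvature that flatness of D forces on nabla, before the symmetry of [S] and the Bianchi
    identity are used. *)
Definition conf_curv u v w : 'rV[R]_n :=
  bil pm v w *: (u *m P) - bil pm u w *: (v *m P)
  + bil gam v w *: (u *m pmr) - bil gam u w *: (v *m pmr)
  + bil qm v w *: (u *m F) - bil qm u w *: (v *m F)
  + bil Phi v w *: (u *m qmr) - bil Phi u w *: (v *m qmr)
  + (bil qm v u - bil qm u v + lam * bil Phi u v) *: (w *m F)
  + (2 * bil Phi u v) *: (dot w pv *: q - dot w ql *: ps)
  - (bil S u v - bil S v u) *: (w *m P).

(** * Consequences of the symmetry of [S] and of the first Bianchi identity *)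

Hypothesis n3 : n%:R - 3 != 0 :> R.
Hypothesis ST : S^T = S.
Hypothesis bianchi : forall k j i, let e k := delta_mx 0 k in
  conf_curv (e k) (e j) (e i) + conf_curv (e j) (e i) (e k)
    + conf_curv (e i) (e k) (e j) = 0.

(** The second index of [S] annihilates xi, hence by symmetry so does the first. This gives
    [xi *m W *m F = 0], and a further factor [F] recovers [xi *m W] up to sign because
    [W *m P = W]. *)
Lemma P_W : P *m W = W.
Proof.
have xiS : xi *m S = 0.
  rewrite -ST -[xi]trmxK -trmx_mul SE WlE -!mulmxA.
  by rewrite -trmx_mul (cm_xiF cm) ?trmx0 ?mulmx0 ?trmx0.
rewrite PE mulmxBl mul1mx -mulmxA.
suff -> : xi *m W = 0 by rewrite mulmx0 subr0.
rewrite -W_P mulmxA -[P]opprK -contact_FF mulmxN mulmxA.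
suff -> : xi *m W *m F = 0 by rewrite mul0mx oppr0.
apply: (can_inj (mulmxK (cm_g cm))); rewrite mul0mx -!mulmxA -PhiE -[Phi]opprK -contact_gFT.
by rewrite !mulmxN (mulmxA W) -WlE -SE xiS oppr0.
Qed.

(* All other terms of the Bianchi identity cancel by the symmetry of [S]. *)
Lemma Phi_T_cyclic (T : 'M[R]_n) k j i h :
  T = 2 *: W - 4 *: (ql^T *m ps) + (2 * lam) *: F ->
  Phi j i * T k h + Phi i k * T j h + Phi k j * T i h = 0.
Proof.
move=> TE; have /rowP/(_ h) := bianchi k j i; rewrite /conf_curv /=.
have SC u v : bil S u v = bil S v u by rewrite bil_tr ST.
have rT x : ((delta_mx 0 x : 'rV[R]_n) *m T) 0 h = T x h by rewrite -rowE mxE.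
rewrite -!rT -(bil_delta Phi j i) -(bil_delta Phi i k) -(bil_delta Phi k j).
move: (delta_mx 0 k) (delta_mx 0 j) (delta_mx 0 i) => u v w.
have Tx x : x *m T = 2 *: (x *m W) - (4 * dot x ql) *: ps + (2 * lam) *: (x *m F).
  by rewrite TE mulmxDr mulmxBr -!scalemxAr mul_dot scalerA.
have pmrx x : x *m pmr = - (x *m W *m F) - dot x pv *: ps + dot x ql *: q + (lam / 2) *: (x *m P).
  by rewrite pmrE !mulmxDr !mulmxN !mul_dot -scalemxAr !mulmxA.
have qmrx x : x *m qmr = x *m W - dot x pv *: q - dot x ql *: ps + (lam / 2) *: (x *m F).
  by rewrite qmrE !mulmxDr !mulmxN !mul_dot -scalemxAr.
rewrite !Tx !pmrx !qmrx pmE qmE !(bil_add, bil_opp, bil_scale, bil_outer).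
rewrite (SC v u) (SC w v) (SC u w) (bil_gamC v u) (bil_gamC w v) (bil_gamC u w).
rewrite (bil_PhiC v u) (bil_PhiC w v) (bil_PhiC u w).
move: (u *m W *m F) (v *m W *m F) (w *m W *m F) (u *m W) (v *m W) (w *m W)
  (u *m P) (v *m P) (w *m P) (u *m F) (v *m F) (w *m F).
move=> uWF vWF wWF uW vW wW uP vP wP uF vF wF.
by rewrite !mxE => B; rewrite -[RHS]B; field.
Qed.

Lemma bianchi_W : W = 2 *: (ql^T *m ps) - lam *: F.
Proof.
have [T TE] : exists T : 'M[R]_n, T = 2 *: W - 4 *: (ql^T *m ps) + (2 * lam) *: F.
  by eexists.
suff T0 : T = 0.
  apply: (scalerI (_ : 2 != 0 :> R)); first by rewrite pnatr_eq0.
  apply/eqP; rewrite -subr_eq0 -[X in _ == X]T0 TE scalerBr !scalerA opprB addrA.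
  by rewrite -natrM addrAC.
have PT : P *m T = T.
  rewrite TE mulmxDr mulmxBr -!scalemxAr P_W contact_PF mulmxA.
  by rewrite -[P]trmxK -trmx_mul ql_PT.
apply/matrixP => k h; rewrite [RHS]mxE.
(* For fixed [k] and [h] the cyclic identity is a matrix identity in [(j, i)] between [Phi] and the
   outer products of row [k] of [Phi] with column [h] of [T]. *)
have [r rd] : exists r : 'rV[R]_n, r = delta_mx 0 k *m Phi by eexists.
have [a ad] : exists a : 'rV[R]_n, a = (col h T)^T by eexists.
have rE i : r 0 i = Phi k i by rewrite rd -rowE mxE.
have aE i : a 0 i = T i h by rewrite ad !mxE.
have E : T k h *: Phi - a^T *m r + r^T *m a = 0.
  apply/matrixP => j i; rewrite !mxE !big_ord1 !mxE !rE !aE -[RHS](Phi_T_cyclic k j i h TE).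
  rewrite (_ : Phi i k = - Phi k i); first by ring.
  by rewrite -{1}[Phi]trmxK contact_PhiT !mxE.
(* [Y] is skew and inverts [Phi] up to [- P], so tracing against it is the contraction with phi;
   [PT] then absorbs the projector. *)
pose Y := invmx g *m F.
have rY : r *m Y = - (delta_mx 0 k *m P).
  by rewrite rd /Y PhiE !mulmxA mulmxK ?(cm_g cm)// -mulmxA contact_FF mulmxN.
have YT : Y^T = - Y.
  by rewrite /Y trmx_mul trmx_inv (cm_gT cm) contact_ginvF opprK.
have Ta : dot (delta_mx 0 k *m P) a = T k h.
  by rewrite /dot ad trmxK colE -mulmxA (mulmxA P) PT -colE -rowE !mxE.
(* The three terms contribute - (n - 1), 1 and 1 times [T k h], so (n - 3) T = 0. *)
have := congr1 (fun X => \tr (X *m Y)) E.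
rewrite mulmxDl mulmxBl -scalemxAl -!mulmxA mxtrD mxtrB mxtrZ !tr_dot rY mul0mx mxtrace0.
have -> : \tr (Phi *m Y) = - (n%:R - 1).
  by rewrite PhiE /Y mulmxA mulmxK ?(cm_g cm)// contact_FF -scaleN1r mxtrZ contact_trP mulN1r.
rewrite dotMl YT mulmxN rY opprK dotNl (dotC a) Ta => E'.
apply: (mulfI n3); rewrite mulr0; lra.
Qed.

(** Once [bianchi_W] eliminates the derivative [W], the four tensors become algebraic in p and q,
    and the symmetry of [pm] and skewness of [qm] become visible. *)
Lemma pm_bianchi : pm = - (pv^T *m pv + ql^T *m ql + (lam / 2) *: gam).
Proof.
have -> : pm = S - pv^T *m pv + ql^T *m ql + (lam / 2) *: gam := pmE.
have -> : S = - (2 *: (ql^T *m ql)) - lam *: gam.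
  rewrite SE WlE bianchi_W mulmxBl -!scalemxAl -mulmxA ps_g -PhiE mulmxBl -!scalemxAl.
  by rewrite -mulmxA pv_FT contact_PhiF mulmxN scalerN.
move: (pv^T *m pv) (ql^T *m ql) => A B.
by apply/matrixP => i j; rewrite !mxE; field.
Qed.

Lemma qm_bianchi : qm = ql^T *m pv - pv^T *m ql - (lam / 2) *: Phi.
Proof.
have -> : qm = Wl - pv^T *m ql - ql^T *m pv + (lam / 2) *: Phi := qmE.
have -> : Wl = 2 *: (ql^T *m pv) - lam *: Phi.
  by rewrite WlE bianchi_W mulmxBl -!scalemxAl -mulmxA ps_g -PhiE.
move: (pv^T *m ql) (ql^T *m pv) => A B.
by apply/matrixP => i j; rewrite !mxE; field.
Qed.

Lemma qmr_bianchi : qmr = ql^T *m ps - pv^T *m q - (lam / 2) *: F.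
Proof.
have -> : qmr = W - pv^T *m q - ql^T *m ps + (lam / 2) *: F := qmrE.
rewrite bianchi_W.
move: (pv^T *m q) (ql^T *m ps) => A B.
by apply/matrixP => i j; rewrite !mxE; field.
Qed.

Lemma pmr_bianchi : pmr = - (pv^T *m ps + ql^T *m q + (lam / 2) *: P).
Proof.
have -> : pmr = - (W *m F) - pv^T *m ps + ql^T *m q + (lam / 2) *: P := pmrE.
have -> : W *m F = 2 *: (ql^T *m q) + lam *: P.
  by rewrite bianchi_W mulmxBl -!scalemxAl -mulmxA psF contact_FF scalerN opprK.
move: (pv^T *m ps) (ql^T *m q) => A B.
by apply/matrixP => i j; rewrite !mxE; field.
Qed.

Lemma pm_sym : pm^T = pm.
Proof.
by rewrite pm_bianchi linearN /= !linearD linearZ /= !trmx_mul !trmxK contact_gamT.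
Qed.

Lemma gam_PT : gam *m P^T = gam.
Proof. by rewrite -contact_Pg -mulmxA contact_gPT -contact_Pg mulmxA contact_PP. Qed.

Lemma gam_FT : gam *m F^T = - Phi.
Proof. by rewrite -contact_Pg -mulmxA contact_gFT mulmxN PhiE mulmxA contact_PF. Qed.

Lemma pm_PT : pm *m P^T = pm.
Proof.
by rewrite pm_bianchi mulNmx !mulmxDl -scalemxAl -!mulmxA pv_PT ql_PT gam_PT.
Qed.

(** This is the relation that defines M from L in the Bochner tensor, carried over to [pm] and
    [qm]. *)
Lemma qm_pm : qm = - (pm *m F^T).
Proof.
rewrite qm_bianchi pm_bianchi mulNmx opprK !mulmxDl -scalemxAl -!mulmxA.
by rewrite pv_FT ql_FT gam_FT !mulmxN scalerN; congr (_ - _); rewrite addrC.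
Qed.

Lemma qm_skew : qm^T = - qm.
Proof.
have PhiC i j : Phi i j = - Phi j i by rewrite -{1}[Phi]trmxK contact_PhiT !mxE.
by apply/matrixP => i j; rewrite qm_bianchi !mxE !big_ord1 !mxE (PhiC j i); ring.
Qed.

Lemma pmr_g : pmr *m g = pm.
Proof.
rewrite pmr_bianchi pm_bianchi mulNmx !mulmxDl -scalemxAl -!mulmxA.
by rewrite ps_g q_g contact_Pg.
Qed.

Lemma qmr_g : qmr *m g = qm.
Proof.
rewrite qmr_bianchi qm_bianchi !mulmxBl -scalemxAl -!mulmxA.
by rewrite ps_g q_g PhiE.
Qed.

(** The skew part of [S] drops out, and the leftover terms carrying [Phi] (those in [q], [ps] and
    [lam]) add up to [- 2] times [w *m qmr] by [qmr_bianchi]. *)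
Lemma conf_curv_bianchi u v w : conf_curv u v w =
  bil pm v w *: (u *m P) - bil pm u w *: (v *m P)
  + bil gam v w *: (u *m pmr) - bil gam u w *: (v *m pmr)
  + bil qm v w *: (u *m F) - bil qm u w *: (v *m F)
  + bil Phi v w *: (u *m qmr) - bil Phi u w *: (v *m qmr)
  - 2 *: (bil qm u v *: (w *m F) + bil Phi u v *: (w *m qmr)).
Proof.
rewrite /conf_curv [bil S u v]bil_tr ST subrr scale0r subr0 -!addrA.
do 8 congr (_ + _).
have -> : bil qm v u = - bil qm u v by rewrite bil_tr qm_skew bil_opp.
rewrite qmr_bianchi !mulmxBr !mul_dot -scalemxAr.
move: (w *m F) (bil qm u v) => wF b.
by apply/rowP => h; rewrite !mxE; field.
Qed.

End Curvature.
End Potential.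
End Pointwise.

(** * The Bochner tensor of a curvature tensor of Bochner form *)

Lemma lowerE (R : realType) n (g T : 'M[R]_n.+1) : lower g T = T *m g.
Proof. by apply/matrixP => i j; rewrite !mxE. Qed.

Lemma raiseE (R : realType) n (g T : 'M[R]_n.+1) : raise g T = T *m invmx g.
Proof. by apply/matrixP => i j; rewrite !mxE. Qed.

Section Bochner.
Context (R : realType) (m : nat).
Context (F g : 'M[R]_(m.*2.+1)) (xi eta : 'rV[R]_(m.*2.+1)).
Context (K : 'I_(m.*2.+1) -> 'I_(m.*2.+1) -> 'I_(m.*2.+1) -> 'I_(m.*2.+1) -> R).
Hypothesis cm : contact_metric F g xi eta.
Context (P gam Phi : 'M[R]_(m.*2.+1)).
Hypothesis PE : P = 1%:M - eta^T *m xi.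
Hypothesis gamE : gam = g - eta^T *m eta.
Hypothesis PhiE : Phi = F *m g.
Context (pm qm pmr qmr : 'M[R]_(m.*2.+1)).
Hypothesis pm_sym : pm^T = pm.
Hypothesis pm_PT : pm *m P^T = pm.
Hypothesis qmE : qm = - (pm *m F^T).
Hypothesis qm_skew : qm^T = - qm.
Hypothesis pmr_g : pmr *m g = pm.
Hypothesis qmr_g : qmr *m g = qm.
Hypothesis KE : forall k j i h, K k j i h =
  P k h * pm j i - P j h * pm k i + pmr k h * gam j i - pmr j h * gam k i
  + F k h * qm j i - F j h * qm k i + qmr k h * Phi j i - qmr j h * Phi k i
  - 2 * (qm k j * F i h + Phi k j * qmr i h).

Lemma P_pm : P *m pm = pm.
Proof. by rewrite -[LHS]trmxK trmx_mul pm_sym pm_PT pm_sym. Qed.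

Lemma F_pm : F *m pm = qm.
Proof.
by rewrite -[RHS]opprK -qm_skew qmE linearN /= opprK trmx_mul pm_sym trmxK.
Qed.

Lemma F_qm : F *m qm = - pm.
Proof. by rewrite -F_pm mulmxA (contact_FF cm PE) mulNmx P_pm. Qed.

Lemma pmrE : pmr = pm *m invmx g.
Proof. by rewrite -pmr_g mulmxK ?(cm_g cm). Qed.

Lemma qmrE : qmr = qm *m invmx g.
Proof. by rewrite -qmr_g mulmxK ?(cm_g cm). Qed.

Lemma ginv_gam : invmx g *m gam = P^T.
Proof. by rewrite -(contact_gPT cm PE gamE) mulKmx ?(cm_g cm). Qed.

Lemma ginv_Phi : invmx g *m Phi = - F^T.
Proof.
by rewrite -[Phi]opprK -(contact_gFT cm PE gamE PhiE) mulmxN mulKmx ?(cm_g cm).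
Qed.

Lemma tr_qmr : \tr qmr = 0.
Proof.
have : \tr qmr = - \tr qmr; last by lra.
rewrite {1}qmrE -mxtrace_tr trmx_mul trmx_inv (cm_gT cm) qm_skew mulmxN.
by rewrite -scaleN1r mxtrZ mulN1r mxtrace_mulC -qmrE.
Qed.

(** The coefficient of [pm] is 2m from the trace of [P], - 2 from the other [P] and [gam] terms, 2
    from the [F] and [Phi] terms and 4 from the last bracket; [F] and [qmr] are traceless. *)
Lemma ricciE : ricci K = (2 * (m.+2)%:R) *: pm + \tr pmr *: gam.
Proof.
have -> : ricci K = \tr P *: pm - P *m pm + \tr pmr *: gam - pmr *m gam
    + \tr F *: qm - F *m qm + \tr qmr *: Phi - qmr *m Phi
    - 2 *: ((F *m qm)^T + (qmr *m Phi)^T).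
  apply/matrixP => j i; rewrite !mxE /mxtrace.
  under eq_bigr do rewrite KE.
  rewrite !(sumrB, big_split) /= !mulr_suml -!mulr_sumr big_split /=.
  congr (_ - _ + _ - _ + _ - _ + _ - _ - _ * (_ + _)); apply: eq_bigr => t _;
    by rewrite mulrC.
rewrite P_pm pmrE qmrE -!mulmxA ginv_gam pm_PT ginv_Phi mulmxN.
rewrite -pmrE -qmrE tr_qmr (contact_trF cm PE gamE PhiE) (contact_trP cm PE) F_qm.
have -> : qm *m F^T = pm.
  apply: trmx_inj; rewrite trmx_mul trmxK qm_skew mulmxN F_qm opprK; exact/esym.
apply/matrixP => j i; rewrite !mxE -[in X in X i j]pm_sym mxE.
have -> : (m.*2.+1)%:R = 2 * m%:R + 1 :> R by rewrite -addn1 natrD -muln2 natrM mulrC.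
have -> : m.+2%:R = m%:R + 2 :> R by rewrite -addn2 natrD.
ring.
Qed.

(** A second trace gives K = (2 (m + 2) + 2 m) tr [pmr], which the denominator 4 (m + 1) cancels. *)
Lemma bochner_traceE : bochner_trace g K = - \tr pmr.
Proof.
have sc : scalar_curvature g K = \tr (invmx g *m (ricci K)^T).
  by rewrite /scalar_curvature /mxtrace; apply: eq_bigr => j _; rewrite [in RHS]mxE;
    apply: eq_bigr => i _; rewrite [in RHS]mxE.
rewrite /bochner_trace sc ricciE linearD !linearZ /= pm_sym (contact_gamT cm gamE).
rewrite mulmxDr -!scalemxAr mxtrD !mxtrZ ginv_gam mxtrace_tr (contact_trP cm PE).
rewrite mxtrace_mulC -pmrE.
have -> : (m.*2.+1)%:R = 2 * m%:R + 1 :> R by rewrite -addn1 natrD -muln2 natrM mulrC.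
have -> : m.+2%:R = m%:R + 2 :> R by rewrite -addn2 natrD.
have -> : m.+1%:R = m%:R + 1 :> R by rewrite -addn1 natrD.
field.
by rewrite natr1 pnatr_eq0.
Qed.

Lemma bochner_LE : bochner_L g eta K = - pm.
Proof.
apply/matrixP => j i; rewrite mxE bochner_traceE ricciE gamE !mxE !big_ord1 !mxE.
have -> : m.+2%:R = m%:R + 2 :> R by rewrite -addn2 natrD.
field.
by rewrite -natrD pnatr_eq0 addn2.
Qed.

Lemma bochner_ME : bochner_M F g eta K = - qm.
Proof.
apply/matrixP => j i; rewrite mxE bochner_LE qmE opprK !mxE -sumrN.
by apply: eq_bigr => t _; rewrite !mxE mulNr opprK.
Qed.

Lemma bochner_eq0 k j i h : bochner F g xi eta K k j i h = 0.
Proof.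
rewrite /bochner bochner_LE bochner_ME !raiseE lowerE -PhiE !mulNmx -pmrE -qmrE KE.
have gam_ij a b : g a b - eta 0 a * eta 0 b = gam a b by rewrite gamE !mxE big_ord1 !mxE.
have P_ij a b : (a == b)%:R - eta 0 a * xi 0 b = P a b.
  by rewrite PE !mxE big_ord1 !mxE.
have opp_ij (X : 'M[R]_(m.*2.+1)) a b : (- X) a b = - X a b by rewrite mxE.
rewrite !gam_ij !P_ij !opp_ij; ring.
Qed.

End Bochner.

(** * Covariant differentiation of matrix fields *)

(** As [f] is only derivable along [v], the one-variable chain rule is applied to its restriction
    [l] to the line through [x]. *)
Lemma is_derive_chain (R : realType) (V : normedModType R) (f : V -> R) (h : R -> R)
    (x v : V) (df dh : R) :
  is_derive x v (f : V -> R^o) df -> is_derive (f x : R) (1 : R) h dh ->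
  is_derive x v (fun y => h (f y) : R^o) (dh * df).
Proof.
move=> [fd fE] [hd hE].
have [l ldef] : exists l : R -> R, l = fun t => f (x + t *: v) by eexists.
have [ld lE] : is_derive (0 : R) (1 : R) l df.
  by rewrite ldef; have := @is_derive_line R V f v x 0; rewrite scale0r addr0 fE; apply.
have l0 : l 0 = f x by rewrite ldef scale0r addr0.
have hdl : derivable h (l 0) 1 by rewrite l0; exact: hd.
have cd : derivable (h \o l) (0 : R) (1 : R).
  by apply/derivable1_diffP/differentiable_comp; apply/derivable1_diffP.
have cE : 'D_(1 : R) (h \o l) (0 : R) = dh * df.
  rewrite -derive1E; apply: etrans (derive1_comp ld hdl) _.
  by rewrite !derive1E l0 lE hE.
have E : (fun t : R => t^-1 *: (((h \o l) \o shift (0 : R)) (t *: (1 : R)) - (h \o l) 0)) =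
  (fun t : R => t^-1 *: (((fun y => h (f y) : R^o) \o shift x) (t *: v) - h (f x))).
  apply/funext => t /=; rewrite l0 ldef; congr (_ *: (h (f _) - _)).
  by rewrite [t *: 1]mulr1 addr0 addrC.
split; first by rewrite /derivable -E.
by rewrite -cE /derive E.
Qed.

Section MatrixDerivative.
Context (R : realType) (n : nat).
Implicit Types (k : 'I_n.+1) (x : 'rV[R]_n.+1).

Definition mxderive a b (X : 'rV[R]_n.+1 -> 'M[R]_(a, b)) k x (X' : 'M[R]_(a, b)) : Prop :=
  forall i j, is_derive x (delta_mx 0 k) (fun y => X y i j : R^o) (X' i j).

Definition pdmx a b (X : 'rV[R]_n.+1 -> 'M[R]_(a, b)) k x : 'M[R]_(a, b) :=
  \matrix_(i, j) pd (fun y => X y i j) k x.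

Lemma mxderive_val a b (X : 'rV[R]_n.+1 -> 'M[R]_(a, b)) k x X' :
  mxderive X k x X' -> pdmx X k x = X'.
Proof. by move=> dX; apply/matrixP => i j; rewrite mxE; case: (dX i j). Qed.

Lemma mxderive_smooth a b (X : 'rV[R]_n.+1 -> 'M[R]_(a, b)) k x (U : set 'rV[R]_n.+1) :
  (forall i j, smooth_on U (fun y => X y i j)) -> U x -> mxderive X k x (pdmx X k x).
Proof.
move=> sX Ux i j; rewrite mxE; apply: derivableP.
by have [_ [/(_ x Ux k)]] := sX i j 1%N.
Qed.

Lemma mxderive_near a b (X Y : 'rV[R]_n.+1 -> 'M[R]_(a, b)) k x X' (U : set 'rV[R]_n.+1) :
  open U -> U x -> (forall y, U y -> X y = Y y) -> mxderive X k x X' -> mxderive Y k x X'.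
Proof.
move=> oU Ux XY dX i j; apply: near_eq_is_derive (dX i j).
by apply: filterS (open_nbhs_nbhs (conj oU Ux)) => y /XY ->.
Qed.

Lemma mxderive_cst a b (X : 'M[R]_(a, b)) k x : mxderive (fun=> X) k x 0.
Proof. by move=> i j; rewrite mxE; exact: is_derive_cst. Qed.

Lemma mxderiveD a b (X Y : 'rV[R]_n.+1 -> 'M[R]_(a, b)) k x X' Y' :
  mxderive X k x X' -> mxderive Y k x Y' -> mxderive (fun y => X y + Y y) k x (X' + Y').
Proof.
move=> dX dY i j; rewrite mxE.
rewrite (_ : (fun y => _) = (fun y => X y i j : R^o) + (fun y => Y y i j : R^o)).
  exact: is_deriveD.
by apply/funext => y; rewrite !fctE mxE.
Qed.

Lemma mxderiveN a b (X : 'rV[R]_n.+1 -> 'M[R]_(a, b)) k x X' :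
  mxderive X k x X' -> mxderive (fun y => - X y) k x (- X').
Proof.
move=> dX i j; rewrite mxE.
rewrite (_ : (fun y => _) = - (fun y => X y i j : R^o)).
  exact: is_deriveN.
by apply/funext => y; rewrite !fctE mxE.
Qed.

Lemma mxderive_tr a b (X : 'rV[R]_n.+1 -> 'M[R]_(a, b)) k x X' :
  mxderive X k x X' -> mxderive (fun y => (X y)^T) k x X'^T.
Proof.
move=> dX i j; rewrite mxE.
by rewrite (_ : (fun y => _) = (fun y => X y j i : R^o)) //; apply/funext => y; rewrite mxE.
Qed.

Lemma mxderiveM a b c (X : 'rV[R]_n.+1 -> 'M[R]_(a, b)) (Y : 'rV[R]_n.+1 -> 'M[R]_(b, c))
    k x X' Y' :
  mxderive X k x X' -> mxderive Y k x Y' ->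
  mxderive (fun y => X y *m Y y) k x (X' *m Y x + X x *m Y').
Proof.
move=> dX dY i j.
rewrite (_ : (fun y => _) =
    \sum_(t < b) ((fun y => X y i t : R^o) * (fun y => Y y t j : R^o))); last first.
  apply/funext => y; rewrite mxE fct_sumE; exact: eq_bigr.
rewrite !mxE -big_split /=; apply: is_derive_sum => t.
apply: is_derive_eq; first exact: is_deriveM (dX i t) (dY t j).
by rewrite addrC; congr (_ + _); exact: mulrC.
Qed.

Lemma mxderiveZ a b (s : 'rV[R]_n.+1 -> R^o) (X : 'rV[R]_n.+1 -> 'M[R]_(a, b)) k x ds X' :
  is_derive x (delta_mx 0 k) s ds -> mxderive X k x X' ->
  mxderive (fun y => s y *: X y) k x (ds *: X x + s x *: X').
Proof.
move=> dS dX i j; rewrite !mxE.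
rewrite (_ : (fun y => _) = s * (fun y => X y i j : R^o)); last first.
  by apply/funext => y; rewrite mxE.
apply: is_derive_eq; first exact: is_deriveM dS (dX i j).
by rewrite addrC; congr (_ + _); exact: mulrC.
Qed.

(* [X'] is the covariant derivative of [X].  With N = (N_{kt}^h) in the indices (t, h), a
   contravariant column index has Q = N and a covariant one Q = - N^T; a covariant row index
   has L = N and a contravariant one L = - N^T; an absent index has 0. *)
Definition cov a b (L : 'M[R]_a) (Q : 'M[R]_b) (X : 'rV[R]_n.+1 -> 'M[R]_(a, b)) k x
    (X' : 'M[R]_(a, b)) : Prop :=
  mxderive X k x (X' + L *m X x - X x *m Q).

Lemma covD a b (L : 'M[R]_a) (Q : 'M[R]_b) X Y k x X' Y' :
  cov L Q X k x X' -> cov L Q Y k x Y' -> cov L Q (fun y => X y + Y y) k x (X' + Y').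
Proof.
move=> dX dY; have := mxderiveD dX dY; congr mxderive.
by rewrite mulmxDr mulmxDl opprD addrACA; congr (_ + _); rewrite addrACA.
Qed.

Lemma covN a b (L : 'M[R]_a) (Q : 'M[R]_b) X k x X' :
  cov L Q X k x X' -> cov L Q (fun y => - X y) k x (- X').
Proof.
move=> dX; have := mxderiveN dX; congr mxderive.
by rewrite mulmxN mulNmx !opprD.
Qed.

Lemma covB a b (L : 'M[R]_a) (Q : 'M[R]_b) X Y k x X' Y' :
  cov L Q X k x X' -> cov L Q Y k x Y' -> cov L Q (fun y => X y - Y y) k x (X' - Y').
Proof. by move=> dX dY; apply: covD => //; exact: covN. Qed.

Lemma cov_tr a b (L : 'M[R]_a) (Q : 'M[R]_b) X k x X' :
  cov L Q X k x X' -> cov (- Q^T) (- L^T) (fun y => (X y)^T) k x X'^T.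
Proof.
move=> dX; have := mxderive_tr dX; congr mxderive.
by rewrite !linearD linearN /= !trmx_mul mulNmx mulmxN opprK addrAC.
Qed.

Lemma covM a b c (L : 'M[R]_a) (Q : 'M[R]_b) (Q2 : 'M[R]_c) X Y k x X' Y' :
  cov L Q X k x X' -> cov Q Q2 Y k x Y' ->
  cov L Q2 (fun y => X y *m Y y) k x (X' *m Y x + X x *m Y').
Proof.
move=> dX dY; have := mxderiveM dX dY; congr mxderive.
rewrite !(mulmxDl, mulmxDr, mulNmx, mulmxN) !mulmxA.
move: (X' *m Y x) (L *m X x *m Y x) (X x *m Q *m Y x) (X x *m Y') (X x *m Y x *m Q2).
move=> A1 A2 A3 A4 A5.
by apply/matrixP => i j; rewrite !mxE; ring.
Qed.

Lemma covZ a b (L : 'M[R]_a) (Q : 'M[R]_b) (s : 'rV[R]_n.+1 -> 'M[R]_1) X k x s' X' :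
  cov 0 0 s k x s' -> cov L Q X k x X' ->
  cov L Q (fun y => s y 0 0 *: X y) k x (s' 0 0 *: X x + s x 0 0 *: X').
Proof.
move=> dS dX; have := mxderiveZ (dS 0 0) dX; congr mxderive.
rewrite mul0mx mulmx0 subr0 addr0 scalerBr scalerDr -scalemxAr -scalemxAl.
by rewrite !addrA.
Qed.

Lemma cov_cst a b (L : 'M[R]_a) (Q : 'M[R]_b) X k x :
  cov L Q (fun=> X) k x (X *m Q - L *m X).
Proof. by have := mxderive_cst X k x; congr mxderive; rewrite subrK subrr. Qed.

End MatrixDerivative.

(** * Flatness in a chart *)

(** A is linear in (p_i, p^h, q_i, q^h) with parallel coefficients, so its covariant derivative is A
    with these replaced by their own derivatives. *)
Lemma conf_bil_cov (R : realFieldType) n (F P gam Phi W Wl S : 'M[R]_n) (e u v : 'rV[R]_n) :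
  conf_bil F P gam Phi (e *m S) (- (e *m W *m F)) (e *m Wl) (e *m W) u v =
  cov_bil F P gam Phi W Wl S e u v.
Proof. by rewrite /conf_bil /cov_bil !(bilE _ e) !(dotC (e *m _)) scalerN opprK. Qed.

(** The purely algebraic conclusion at one point: of the analysis only the value [W] of nabla q, the
    symmetry of [S], the expression of K by flatness and the first Bianchi identity remain. *)
Lemma flat_bochner_eq0 (R : realType) (m : nat) (F g : 'M[R]_(m.*2.+1))
    (xi eta q ps : 'rV[R]_(m.*2.+1)) (W : 'M[R]_(m.*2.+1))
    (K : 'I_(m.*2.+1) -> 'I_(m.*2.+1) -> 'I_(m.*2.+1) -> 'I_(m.*2.+1) -> R) :
  (2 < m)%N -> contact_metric F g xi eta ->
  let P := 1%:M - eta^T *m xi in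
  let gam := g - eta^T *m eta in
  let Phi := F *m g in
  let S := W *m g *m F^T in
  let e k : 'rV[R]_(m.*2.+1) := delta_mx 0 k in
  let a := conf_bil F P gam Phi (ps *m g) ps (q *m g) q in
  let da := cov_bil F P gam Phi W (W *m g) S in
  q *m F = - ps -> q *m P = q -> W *m P = W -> S^T = S ->
  (forall k j i h, K k j i h =
    (- (da (e k) (e j) (e i) - da (e j) (e k) (e i)
       + a (e k) (a (e j) (e i)) - a (e j) (a (e k) (e i)))) 0 h) ->
  (forall k j i h, K k j i h + K j i k h + K i k j h = 0) ->
  forall k j i h, bochner F g xi eta K k j i h = 0.
Proof.
move=> m2 cm P gam Phi S e a da qF qP WP ST KE Kcyc.
have n3 : (m.*2.+1)%:R - 3 != 0 :> R.
  by rewrite subr_eq0 (eqr_nat R _ 3) eqSS -[2%N]/(1.*2) (inj_eq double_inj)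
    gtn_eqF // (ltn_trans _ m2).
pose lam := dot ps (ps *m g).
pose pv := ps *m g; pose ql := q *m g.
pose pm := S - pv^T *m pv + ql^T *m ql + (lam / 2) *: gam.
pose qm := W *m g - pv^T *m ql - ql^T *m pv + (lam / 2) *: Phi.
pose pmr := - (W *m F) - pv^T *m ps + ql^T *m q + (lam / 2) *: P.
pose qmr := W - pv^T *m q - ql^T *m ps + (lam / 2) *: F.
pose cc := conf_curv F P gam Phi pv ps ql q lam S pm qm pmr qmr.
have Kcc k j i h : K k j i h = cc (e k) (e j) (e i) 0 h.
  rewrite KE; apply: (congr1 (fun X : 'rV[R]_(m.*2.+1) => X 0 h)).
  exact: (conf_curvature cm (erefl P) (erefl gam) (erefl Phi) (erefl pv) (erefl ql) qF qP
    (W := W) (Wl := W *m g) (S := S) (erefl lam) (erefl pm) (erefl qm) (erefl pmr)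
    (erefl qmr)).
have B k j i : cc (e k) (e j) (e i) + cc (e j) (e i) (e k) + cc (e i) (e k) (e j) = 0.
  apply/rowP => h; rewrite mxE [X in X + _ = _]mxE [RHS]mxE.
  by have := Kcyc k j i h; rewrite !Kcc.
apply: (bochner_eq0 cm (erefl P) (erefl gam) (erefl Phi) (pm := pm) (qm := qm) (pmr := pmr)
  (qmr := qmr)).
- exact: (pm_sym cm (erefl P) (erefl gam) (erefl Phi) (erefl pv) (erefl ql) qF qP WP
    (erefl (W *m g)) (erefl S) (erefl pm) (erefl qm) (erefl pmr) (erefl qmr) n3 ST B).
- exact: (pm_PT cm (erefl P) (erefl gam) (erefl Phi) (erefl pv) (erefl ql) qF qP WP
    (erefl (W *m g)) (erefl S) (erefl pm) (erefl qm) (erefl pmr) (erefl qmr) n3 ST B).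
- exact: (qm_pm cm (erefl P) (erefl gam) (erefl Phi) (erefl pv) (erefl ql) qF qP WP
    (erefl (W *m g)) (erefl S) (erefl pm) (erefl qm) (erefl pmr) (erefl qmr) n3 ST B).
- exact: (qm_skew cm (erefl P) (erefl gam) (erefl Phi) (erefl pv) (erefl ql) qP WP
    (erefl (W *m g)) (erefl S) (erefl pm) (erefl qm) (erefl pmr) (erefl qmr) n3 ST B).
- exact: (pmr_g cm (erefl P) (erefl gam) (erefl Phi) (erefl pv) (erefl ql) qF qP WP
    (erefl (W *m g)) (erefl S) (erefl pm) (erefl qm) (erefl pmr) (erefl qmr) n3 ST B).
- exact: (qmr_g cm (erefl P) (erefl gam) (erefl Phi) (erefl pv) (erefl ql) qP WP
    (erefl (W *m g)) (erefl S) (erefl pm) (erefl qm) (erefl pmr) (erefl qmr) n3 ST B).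
move=> k j i h; rewrite Kcc.
rewrite [cc _ _ _](conf_curv_bianchi cm (erefl P) (erefl gam) (erefl Phi) (erefl pv) (erefl ql)
  qP WP (erefl (W *m g)) (erefl S) (erefl pm) (erefl qm) (erefl pmr) (erefl qmr) n3 ST B).
rewrite !bil_delta /e -!rowE.
move: (P) (gam) (Phi) (pm) (qm) (pmr) (qmr) => P0 gam0 Phi0 pm0 qm0 pmr0 qmr0.
by rewrite !mxE; ring.
Qed.

(** * Covariant derivatives of the tensors built from phi, g, xi and q *)

Section Chart.
Context (R : realType) (n : nat).
Context (phi g : 'rV[R]_n.+1 -> 'M[R]_n.+1) (xi q : 'rV[R]_n.+1 -> 'rV[R]_n.+1).
Context (x : 'rV[R]_n.+1) (k : 'I_n.+1) (Nk : 'M[R]_n.+1) (w : 'rV[R]_n.+1).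
Hypothesis dphi : cov Nk Nk phi k x 0.
Hypothesis dg : cov Nk (- Nk^T) g k x 0.
Hypothesis dxi : cov (0 : 'M[R]_1) Nk xi k x 0.
Hypothesis dq : cov (0 : 'M[R]_1) Nk q k x w.

Definition eta_of y := xi y *m g y.
Definition P_of y : 'M[R]_n.+1 := 1%:M - (eta_of y)^T *m xi y.
Definition gam_of y : 'M[R]_n.+1 := g y - (eta_of y)^T *m eta_of y.
Definition Phi_of y := phi y *m g y.
Definition ps_of y : 'rV[R]_n.+1 := - (q y *m phi y).
Definition pv_of y := ps_of y *m g y.
Definition ql_of y := q y *m g y.

Lemma cov_form_tr (X : 'rV[R]_n.+1 -> 'rV[R]_n.+1) X' :
  cov (0 : 'M[R]_1) (- Nk^T) X k x X' -> cov Nk (0 : 'M[R]_1) (fun y => (X y)^T) k x X'^T.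
Proof. by move/cov_tr; rewrite linearN /= trmxK opprK trmx0 oppr0. Qed.

Lemma cov_eta : cov (0 : 'M[R]_1) (- Nk^T) eta_of k x 0.
Proof. by have := covM dxi dg; rewrite mul0mx mulmx0 addr0. Qed.

Lemma cov_P : cov Nk Nk P_of k x 0.
Proof.
have := covB (cov_cst Nk Nk 1%:M k x) (covM (cov_form_tr cov_eta) dxi).
by rewrite trmx0 mul0mx mulmx0 mulmx1 mul1mx subrr addr0 subr0.
Qed.

Lemma cov_gam : cov Nk (- Nk^T) gam_of k x 0.
Proof.
have := covB dg (covM (cov_form_tr cov_eta) cov_eta).
by rewrite trmx0 mul0mx mulmx0 addr0 subr0.
Qed.

Lemma cov_Phi : cov Nk (- Nk^T) Phi_of k x 0.
Proof. by have := covM dphi dg; rewrite mul0mx mulmx0 addr0. Qed.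

Lemma cov_ps : cov (0 : 'M[R]_1) Nk ps_of k x (- (w *m phi x)).
Proof. by have := covN (covM dq dphi); rewrite mulmx0 addr0. Qed.

Lemma cov_pv : cov (0 : 'M[R]_1) (- Nk^T) pv_of k x (- (w *m phi x) *m g x).
Proof. by have := covM cov_ps dg; rewrite mulmx0 addr0. Qed.

Lemma cov_ql : cov (0 : 'M[R]_1) (- Nk^T) ql_of k x (w *m g x).
Proof. by have := covM dq dg; rewrite mulmx0 addr0. Qed.

Lemma cov_row (u : 'rV[R]_n.+1) : cov (0 : 'M[R]_1) Nk (fun=> u) k x (u *m Nk).
Proof. by have := cov_cst (0 : 'M[R]_1) Nk u k x; rewrite mul0mx subr0. Qed.

(* A is a parallel multilinear expression in (p, q) and the constant row [u], so its covariant
   derivative is the sum of the same expressions in their covariant derivatives. *)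
Lemma cov_conf_op (u : 'rV[R]_n.+1) :
  cov Nk Nk (fun y => conf_op (phi y) (P_of y) (gam_of y) (Phi_of y) (pv_of y) (ps_of y)
      (ql_of y) (q y) u) k x
    (conf_op (phi x) (P_of x) (gam_of x) (Phi_of x) (- (w *m phi x) *m g x) (- (w *m phi x))
        (w *m g x) w u +
     conf_op (phi x) (P_of x) (gam_of x) (Phi_of x) (pv_of x) (ps_of x) (ql_of x) (q x)
        (u *m Nk)).
Proof.
have t1 := covZ (covM (cov_row u) (cov_form_tr cov_pv)) cov_P.
have t2 := covM (cov_form_tr cov_pv) (covM (cov_row u) cov_P).
have t3 := covM (cov_form_tr (covM (cov_row u) cov_gam)) cov_ps.
have t4 := covM (cov_form_tr cov_ql) (covM (cov_row u) dphi).
have t5 := covZ (covM (cov_row u) (cov_form_tr cov_ql)) dphi.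
have t6 := covM (cov_form_tr (covM (cov_row u) cov_Phi)) dq.
have := covB (covD (covD (covB (covD t1 t2) t3) t4) t5) t6.
congr cov; rewrite /conf_op /dot !mulmx0 !addr0 !scaler0 !addr0.
set s := - (w *m phi x) *m g x; set z := - (w *m phi x).
have addE a b (X Y : 'M[R]_(a, b)) i j : (X + Y) i j = X i j + Y i j by rewrite mxE.
have oppE (X : 'M[R]_n.+1) i j : (- X) i j = - X i j by rewrite mxE.
have scaleE c (X : 'M[R]_n.+1) i j : (c *: X) i j = c * X i j by rewrite mxE.
by apply/matrixP => i j; rewrite !(addE, oppE, scaleE); ring.
Qed.

End Chart.

(** * Curvature in matrix form, the Bianchi identity and the use of flatness *)

Definition conn_mx (R : realType) (n : nat)
    (G : 'rV[R]_n.+1 -> 'I_n.+1 -> 'I_n.+1 -> 'I_n.+1 -> R) (k : 'I_n.+1)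
    (y : 'rV[R]_n.+1) : 'M[R]_n.+1 := \matrix_(i, h) G y k i h.

(** Rows are multiplied from the right, so the product Gamma_{kt}^h Gamma_{ji}^t appears in the
    reversed order, [conn_mx G j x *m conn_mx G k x]. *)
Lemma curvature_mxE (R : realType) (n : nat)
    (G : 'rV[R]_n.+1 -> 'I_n.+1 -> 'I_n.+1 -> 'I_n.+1 -> R) x k j i h :
  curvature G x k j i h =
  (pdmx (conn_mx G j) k x - pdmx (conn_mx G k) j x
   + conn_mx G j x *m conn_mx G k x - conn_mx G k x *m conn_mx G j x) i h.
Proof.
have dE a b : pdmx (conn_mx G a) b x i h = pd (fun y => G y a i h) b x.
  by rewrite mxE; congr (pd _ b x); apply/funext => y; rewrite mxE.
have mE a b : (conn_mx G a x *m conn_mx G b x) i h = \sum_t G x b t h * G x a i t.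
  by rewrite mxE; apply: eq_bigr => t _; rewrite !mxE mulrC.
by rewrite /curvature !(mx_addE, mx_oppE) !dE !mE.
Qed.

Lemma pd_near (R : realType) (n : nat) (U : set 'rV[R]_n.+1) (f h : 'rV[R]_n.+1 -> R) i x :
  open U -> U x -> (forall y, U y -> f y = h y) -> pd f i x = pd h i x.
Proof.
move=> oU Ux fh; apply: near_eq_derive.
by apply: filterS (open_nbhs_nbhs (conj oU Ux)) => y /fh.
Qed.

(** Symmetry of [G] on a whole neighbourhood lets the derivative terms cancel in pairs, as the
    quadratic ones do. *)
Lemma curvature_bianchi (R : realType) (n : nat) (U : set 'rV[R]_n.+1)
    (G : 'rV[R]_n.+1 -> 'I_n.+1 -> 'I_n.+1 -> 'I_n.+1 -> R) x k j i h :
  open U -> U x -> (forall y j i h, U y -> G y j i h = G y i j h) ->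
  curvature G x k j i h + curvature G x j i k h + curvature G x i k j h = 0.
Proof.
move=> oU Ux Gs.
have dG a b c : pd (fun y => G y b c h) a x = pd (fun y => G y c b h) a x.
  by apply: (pd_near _ oU Ux) => y Uy; exact: Gs.
have sG a b c : \sum_t G x a t h * G x b c t = \sum_t G x a t h * G x c b t.
  by apply: eq_bigr => t _; rewrite (Gs x b c t Ux).
rewrite /curvature (dG k i j) (dG j k i) (dG i j k).
rewrite (sG k i j) (sG j k i) (sG i j k); ring.
Qed.

Lemma chart_bochner_eq0 (R : realType) (m : nat) (U : set 'rV[R]_(m.*2.+1))
    (phi g : 'rV[R]_(m.*2.+1) -> 'M[R]_(m.*2.+1))
    (xi q : 'rV[R]_(m.*2.+1) -> 'rV[R]_(m.*2.+1)) (p : 'rV[R]_(m.*2.+1) -> R)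
    (G D : 'rV[R]_(m.*2.+1) -> 'I_(m.*2.+1) -> 'I_(m.*2.+1) -> 'I_(m.*2.+1) -> R) x :
  (2 < m)%N -> open U -> U x ->
  (forall y, U y -> contact_metric (phi y) (g y) (xi y) (eta_of g xi y)) ->
  (forall k, cov (conn_mx G k x) (conn_mx G k x) phi k x 0) ->
  (forall k, cov (conn_mx G k x) (- (conn_mx G k x)^T) g k x 0) ->
  (forall k, cov (0 : 'M[R]_1) (conn_mx G k x) xi k x 0) ->
  (forall k, mxderive q k x (pdmx q k x)) ->
  (forall k j, mxderive (conn_mx G j) k x (pdmx (conn_mx G j) k x)) ->
  (forall y j i h, U y -> G y j i h = G y i j h) ->
  Ck 2 U p ->
  (forall y i, U y -> pv_of phi g q y 0 i = pd p i y) ->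
  (forall y, U y -> q y *m P_of g xi y = q y) ->
  (forall y j, U y -> conn_mx D j y = conn_mx G j y +
     conf_op (phi y) (P_of g xi y) (gam_of g xi y) (Phi_of phi g y) (pv_of phi g q y)
       (ps_of phi q y) (ql_of g q y) (q y) (delta_mx 0 j)) ->
  (forall k j i h, curvature D x k j i h = 0) ->
  forall k j i h,
    bochner (phi x) (g x) (xi x) (eta_of g xi x) (curvature G x) k j i h = 0.
Proof.
move=> m2 oU Ux hcm dphi dg dxi dq0 dG Gs pC2 hp qP hD flat.
have cmx := hcm x Ux.
pose e k : 'rV[R]_(m.*2.+1) := delta_mx 0 k.
pose W : 'M[R]_(m.*2.+1) := \matrix_(k, h) (pdmx q k x + q x *m conn_mx G k x) 0 h.
have eW k : e k *m W = pdmx q k x + q x *m conn_mx G k x.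
  by apply/rowP => h; rewrite -rowE !mxE.
have dq k : cov (0 : 'M[R]_1) (conn_mx G k x) q k x (e k *m W).
  by have := dq0 k; congr mxderive; rewrite eW mul0mx addr0 addrK.
(* The identity [qP] holds around [x] and [P] is parallel, so it can be differentiated
   covariantly. *)
have WP : W *m P_of g xi x = W.
  apply/row_matrixP => k; rewrite row_mul rowE -/(e k).
  have c := covM (dq k) (cov_P (dg k) (dxi k)).
  have /mxderive_val := mxderive_near oU Ux qP c; rewrite (mxderive_val (dq k)).
  by rewrite !mul0mx !addr0 mulmx0 addr0 (qP x Ux) => /addIr <-.
have gFT : g x *m (phi x)^T = - Phi_of phi g x.
  exact: (contact_gFT cmx (erefl (P_of g xi x)) (erefl (gam_of g xi x)) (erefl _)).
pose S := W *m g x *m (phi x)^T.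
have eS k : - (e k *m W *m phi x) *m g x = e k *m S.
  by rewrite /S -[W *m _ *m _]mulmxA gFT mulmxN mulNmx mulmxN /Phi_of !mulmxA.
(* [S] is the covariant Hessian of [p]: second partial derivatives commute, and the connection term
   is symmetric by absence of torsion. *)
have ST : S^T = S.
  apply/matrixP => j k; rewrite mxE.
  have ES a b : S a b = pd (pd p b) a x - (pv_of phi g q x *m (conn_mx G a x)^T) 0 b.
    have c := cov_pv (dphi a) (dg a) (dq a); rewrite eS in c.
    have /mxderive_val/matrixP/(_ 0 b) := c.
    rewrite mul0mx addr0 mulmxN opprK mx_addE => E.
    have -> : pd (pd p b) a x = (pdmx (pv_of phi g q) a x) 0 b.
      by rewrite mxE; apply: (pd_near _ oU Ux) => y Uy; rewrite hp.
    by rewrite E addrK /e -rowE [RHS]mxE.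
  rewrite !ES (pd_comm j k oU pC2 Ux); congr (_ - _).
  by rewrite !mxE; apply: eq_bigr => t _; rewrite !mxE (Gs x k j t Ux).
have [A AE] : exists A : 'rV[R]_(m.*2.+1) -> 'M[R]_(m.*2.+1), A =
    conf_op (phi x) (P_of g xi x) (gam_of g xi x) (Phi_of phi g x) (pv_of phi g q x)
       (ps_of phi q x) (ql_of g q x) (q x) by eexists.
have [A' AE'] : exists A' : 'I_(m.*2.+1) -> 'rV[R]_(m.*2.+1) -> 'M[R]_(m.*2.+1), A' = fun k =>
    conf_op (phi x) (P_of g xi x) (gam_of g xi x) (Phi_of phi g x)
      (e k *m S) (- (e k *m W *m phi x)) (e k *m (W *m g x)) (e k *m W) by eexists.
have hDx j : conn_mx D j x = conn_mx G j x + A (e j) by rewrite AE hD.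
have dD k j : pdmx (conn_mx D j) k x = pdmx (conn_mx G j) k x +
    (A' k (e j) + A (e j *m conn_mx G k x) + conn_mx G k x *m A (e j) - A (e j) *m conn_mx G k x).
  apply: mxderive_val.
  have c := cov_conf_op (dphi k) (dg k) (dxi k) (dq k) (e j).
  rewrite eS -(mulmxA (e k) W (g x)) in c; rewrite AE AE'.
  have d := mxderiveD (dG k j) c.
  by apply: mxderive_near oU Ux _ d => y Uy; rewrite hD.
(* Torsion-freeness makes the terms [A (e j *m conn_mx G k x)] cancel under antisymmetrization in
   [k] and [j]. *)
have eG k j : e j *m conn_mx G k x = e k *m conn_mx G j x.
  by apply/rowP => h; rewrite -!rowE !mxE Gs.
(* The curvature of nabla + A is that of nabla plus nabla_k A_j - nabla_j A_k and the commutator; it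
   vanishes. *)
have KM k j : pdmx (conn_mx G j) k x - pdmx (conn_mx G k) j x
   + conn_mx G j x *m conn_mx G k x - conn_mx G k x *m conn_mx G j x
   = - (A' k (e j) - A' j (e k) + A (e j) *m A (e k) - A (e k) *m A (e j)).
  apply/eqP; rewrite -addr_eq0; apply/eqP/matrixP => i h; rewrite [RHS]mxE.
  rewrite -(flat k j i h) curvature_mxE !dD !hDx (eG k j).
  rewrite !(mulmxDl, mulmxDr).
  rewrite !(mx_addE, mx_oppE); ring.
have rE (X : 'M[R]_(m.*2.+1)) i h : (e i *m X) 0 h = X i h by rewrite /e -rowE mxE.
have KA k j i h : curvature G x k j i h =
    (- (e i *m A' k (e j) - e i *m A' j (e k)
        + e i *m A (e j) *m A (e k) - e i *m A (e k) *m A (e j))) 0 h.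
  rewrite curvature_mxE KM -[LHS]rE mulmxN mulmxBr mulmxDr mulmxBr !mulmxA //.
apply: (flat_bochner_eq0 (W := W) (ps := ps_of phi q x) m2 cmx _ (qP x Ux) WP ST).
- by rewrite /ps_of opprK.
- by move=> k j i h; rewrite KA AE AE' !mul_conf_op !conf_bil_cov.
- move=> k j i h; exact: (curvature_bianchi k j i h oU Ux Gs).
Qed.

(** * From the manifold to a chart *)

(** The vector p^h is first taken as [r], with the index of [pv] raised by the inverse metric. Then
    [rF] and the horizontality of [r] identify it with [- (q *m F)]. *)
Lemma conf_determined (R : realFieldType) n (F g : 'M[R]_n) (xi eta pv q : 'rV[R]_n)
    (A : 'I_n -> 'M[R]_n) :
  contact_metric F g xi eta -> n%:R - 1 != 0 :> R -> n%:R - 3 != 0 :> R ->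
  (forall k, A k *m g + g *m (A k)^T = 2 * pv 0 k *: (g - eta^T *m eta)) ->
  (forall k j h, A k j h - A j k h = - 2 * (F *m g) k j * q 0 h) ->
  (forall k, F *m A k = A k *m F) -> (forall k, xi *m A k = 0) ->
  let ps := - (q *m F) in
  [/\ ps *m g = pv, q *m (1%:M - eta^T *m xi) = q &
    forall k, A k = conf_op F (1%:M - eta^T *m xi) (g - eta^T *m eta) (F *m g) pv ps (q *m g) q
      (delta_mx 0 k)].
Proof.
move=> cm n1 n3 Am At AF Ax ps.
have eP := erefl (1%:M - eta^T *m xi); have eg := erefl (g - eta^T *m eta).
have eF := erefl (F *m g); have eq := erefl (q *m g).
pose r := pv *m invmx g.
have rg : r *m g = pv by rewrite mulmxKV ?(cm_g cm).
have [pxi qxi] := pv_xi_ql_xi cm eP eg eF rg eq Am At Ax n1.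
have dot_eta u : dot u eta = dot xi (u *m g).
  by rewrite (cm_eta cm) -{1}(cm_gT cm) -dotMl dotC.
have horizontal u : dot xi (u *m g) = 0 -> u *m (1%:M - eta^T *m xi) = u.
  by move=> h; rewrite mulmxBr mulmx1 mul_dot dot_eta h scale0r subr0.
have rF : r *m F = q.
  apply: (can_inj (mulmxK (cm_g cm))); rewrite (ps_F cm eP eg eF rg).
  by rewrite -(ql_pv cm eP eg eF rg eq Am At AF Ax n1 n3).
have psr : ps = r.
  by rewrite /ps -rF -mulmxA (contact_FF cm eP) mulmxN opprK horizontal ?rg.
split; rewrite ?psr //; first exact: horizontal.
exact: (conf_op_unique cm eP eg eF rg eq Am At).
Qed.

Lemma conn_mx_ij (R : realType) n (G : 'rV[R]_n.+1 -> 'I_n.+1 -> 'I_n.+1 -> 'I_n.+1 -> R)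
  k y i h : conn_mx G k y i h = G y k i h.
Proof. by rewrite mxE. Qed.

(** * Covariant derivatives in components as matrix identities *)

Section ConnMx.
Context (R : realType) (n : nat).
Implicit Types (G : 'rV[R]_n.+1 -> 'I_n.+1 -> 'I_n.+1 -> 'I_n.+1 -> R).

Lemma cov_t02_mxE G T x k j i : cov_t02 G T x k j i =
  (pdmx T k x - conn_mx G k x *m T x - T x *m (conn_mx G k x)^T) j i.
Proof.
rewrite /cov_t02 !(mx_addE, mx_oppE); congr (_ - _ - _).
- by rewrite mxE.
- by rewrite mxE; apply: eq_bigr => t _; rewrite mxE.
- by rewrite mxE; apply: eq_bigr => t _; rewrite !mxE mulrC.
Qed.

Lemma cov_t11_mxE G T x k i h : cov_t11 G T x k i h =
  (pdmx T k x + T x *m conn_mx G k x - conn_mx G k x *m T x) i h.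
Proof.
rewrite /cov_t11 !(mx_addE, mx_oppE); congr (_ + _ - _).
- by rewrite mxE.
- by rewrite mxE; apply: eq_bigr => t _; rewrite mxE mulrC.
- by rewrite mxE; apply: eq_bigr => t _; rewrite mxE.
Qed.

Lemma cov_vec_mxE G v x k h : cov_vec G v x k h =
  (pdmx v k x + v x *m conn_mx G k x) 0 h.
Proof.
rewrite /cov_vec mx_addE; congr (_ + _); first by rewrite mxE.
by rewrite mxE; apply: eq_bigr => t _; rewrite mxE mulrC.
Qed.

Lemma cov_t02P G T x k : mxderive T k x (pdmx T k x) ->
  (forall j i, cov_t02 G T x k j i = 0) ->
  cov (conn_mx G k x) (- (conn_mx G k x)^T) T k x 0.
Proof.
move=> dT H; have := dT; congr mxderive; apply/matrixP => j i.
have := H j i; rewrite cov_t02_mxE mulmxN add0r opprK !(mx_addE, mx_oppE) => E.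
by apply/eqP; rewrite -subr_eq0 opprD addrA E.
Qed.

Lemma cov_t11P G T x k : mxderive T k x (pdmx T k x) ->
  (forall j i, cov_t11 G T x k j i = 0) ->
  cov (conn_mx G k x) (conn_mx G k x) T k x 0.
Proof.
move=> dT H; have := dT; congr mxderive; apply/matrixP => j i.
have := H j i; rewrite cov_t11_mxE add0r !(mx_addE, mx_oppE) => E.
by apply/eqP; rewrite -subr_eq0 -E; apply/eqP; ring.
Qed.

Lemma cov_vecP G v x k : mxderive v k x (pdmx v k x) ->
  (forall h, cov_vec G v x k h = 0) ->
  cov (0 : 'M[R]_1) (conn_mx G k x) v k x 0.
Proof.
move=> dT H; have := dT; congr mxderive; apply/rowP => h.
have := H h; rewrite cov_vec_mxE add0r mul0mx add0r mx_addE mx_oppE => /eqP.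
by rewrite addr_eq0 => /eqP.
Qed.

End ConnMx.

(** * The structure tensors in a chart *)

Section Atlas.
Context (R : realType) (n : nat) (M : smooth_manifold R n) (S : almost_contact_metric M).
Context (a : chart M) (y : 'rV[R]_n.+1) (Uy : cod a y).

Lemma acm_eta_of : acm_eta S a y = eta_of (acm_g S a) (acm_xi S a) y.
Proof.
apply/rowP => i; rewrite (acm_eta_g S Uy) mxE; apply: eq_bigr => h _.
by rewrite (Defs.metric_sym (acm_g S) i h Uy) mulrC.
Qed.

(** A nonzero row in the kernel would have g(v, v) = 0, against positivity. *)
Lemma metric_unit : acm_g S a y \in unitmx.
Proof.
rewrite -row_free_unit; apply: inj_row_free => v vg; apply/eqP/negPn/negP => v0.
have := Defs.metric_pos (acm_g S) Uy v0.
suff -> : \sum_j \sum_i acm_g S a y j i * v 0 j * v 0 i = 0 by rewrite ltxx.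
rewrite exchange_big big1 //= => i _; rewrite -mulr_suml.
have /rowP/(_ i) := vg; rewrite !mxE => E.
rewrite (_ : \sum_j _ = 0) ?mul0r // -[RHS]E.
by apply: eq_bigr => j _; rewrite mulrC.
Qed.

Lemma acm_contact_metric : contact_metric (acm_phi S a y) (acm_g S a y) (acm_xi S a y)
  (eta_of (acm_g S a) (acm_xi S a) y).
Proof.
rewrite -acm_eta_of; split.
- apply/matrixP => j h; rewrite mxE (acm_phi_sq S Uy) !(mx_addE, mx_oppE) addrC.
  by rewrite !mxE big_ord1 mxE.
- apply/rowP => h; rewrite !mxE -[RHS](acm_phi_xi S Uy h).
  by apply: eq_bigr => t _; rewrite mulrC.
- apply/colP => j; rewrite !mxE -[RHS](acm_eta_phi S Uy j).
  by apply: eq_bigr => t _; rewrite mxE mulrC.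
- rewrite /dot mxE -[RHS](acm_eta_xi S Uy).
  by apply: eq_bigr => t _; rewrite mxE mulrC.
- apply/matrixP => j i.
  have -> : (acm_g S a y - (acm_eta S a y)^T *m acm_eta S a y) j i =
      acm_g S a y j i - acm_eta S a y 0 j * acm_eta S a y 0 i by rewrite !mxE big_ord1 mxE.
  rewrite -(acm_compat S Uy) exchange_big mxE /=.
  apply: eq_bigr => t _; rewrite !mxE mulr_suml; apply: eq_bigr => s _.
  by rewrite (mulrC (acm_g S a y s t)).
- exact: acm_eta_of.
- by apply/matrixP => j i; rewrite mxE (Defs.metric_sym (acm_g S) i j Uy).
- exact: metric_unit.
Qed.

End Atlas.

Lemma is_derive_exp2 (R : realType) n (p : 'rV[R]_n.+1 -> R) x k :
  derivable (p : _ -> R^o) x (delta_mx 0 k) ->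
  is_derive x (delta_mx 0 k) (fun y => expR (2 * p y) : R^o)
    (2 * expR (2 * p x) * pd p k x).
Proof.
move=> dp.
have d2 : is_derive x (delta_mx 0 k) ((fun y => 2 * p y) : 'rV[R]_n.+1 -> R^o) (2 * pd p k x).
  exact: (is_deriveZ (2 : R) (derivableP dp)).
apply: is_derive_eq; first exact: (is_derive_chain d2 (is_derive_expR _)).
by rewrite mulrCA mulrA.
Qed.

Theorem theorem4p1 (R : realType) (m : nat) (hm : (2 < m)%N)
    (M : smooth_manifold R m.*2) (S : almost_contact_metric M)
    (nabla : affine_connection M) (hS : cosymplectic S nabla)
    (D : affine_connection M) (hD : cosymplectic_conformal S D)
    (hflat : zero_curvature D) :
  forall (a : chart M) (x : 'rV[R]_(m.*2.+1)), cod a x ->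
  forall k j i h : 'I_(m.*2.+1), cosymplectic_bochner S nabla a x k j i h = 0%R.
Proof.
move=> a x Ux; case: hD => p [q hpq]; case: hS => hLC hpar.
have oU := @cod_open _ _ M a.
have Ck_p n : Ck n (cod a) (scalar_comp p a) := @scalar_smooth _ _ _ p a n.
have dphi0 y k : cod a y -> mxderive (acm_phi S a) k y (pdmx (acm_phi S a) k y).
  by apply: mxderive_smooth => i h; exact: t11_smooth.
have dg0 y k : cod a y -> mxderive (acm_g S a) k y (pdmx (acm_g S a) k y).
  by apply: mxderive_smooth => i h; exact: metric_smooth.
have dxi0 y k : cod a y -> mxderive (acm_xi S a) k y (pdmx (acm_xi S a) k y).
  by apply: mxderive_smooth => i h; rewrite ord1; exact: vec_smooth.
have dphi y k : cod a y -> cov (conn_mx (nabla a) k y) (conn_mx (nabla a) k y) (acm_phi S a) k y 0.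
  by move=> Uy; apply: cov_t11P => [|i h]; [exact: dphi0|have [-> _] := hpar a y Uy].
have dg y k : cod a y ->
    cov (conn_mx (nabla a) k y) (- (conn_mx (nabla a) k y)^T) (acm_g S a) k y 0.
  by move=> Uy; apply: cov_t02P => [|i h]; [exact: dg0|have [_ ->] := hLC a y Uy].
have dxi y k : cod a y -> cov (0 : 'M[R]_1) (conn_mx (nabla a) k y) (acm_xi S a) k y 0.
  by move=> Uy; apply: cov_vecP => [|h]; [exact: dxi0|have [_ ->] := hpar a y Uy].
(* The determination of D - nabla is proved at every point of the chart, because the resulting
   identities are differentiated afterwards. *)
have det y : cod a y ->
  let ps := ps_of (acm_phi S a) (q a) y in
  [/\ ps *m acm_g S a y = \row_i pd (scalar_comp p a) i y,
      q a y *m P_of (acm_g S a) (acm_xi S a) y = q a y &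
    forall k, conn_mx (D a) k y - conn_mx (nabla a) k y =
      conf_op (acm_phi S a y) (P_of (acm_g S a) (acm_xi S a) y)
       (gam_of (acm_g S a) (acm_xi S a) y) (Phi_of (acm_phi S a) (acm_g S a) y)
       (\row_i pd (scalar_comp p a) i y) ps (ql_of (acm_g S a) (q a) y) (q a y) (delta_mx 0 k)].
  move=> Uy; have [hmet hphi hxi htor] := hpq a y Uy.
  apply: conf_determined (acm_contact_metric S Uy) _ _ _ _ _ _.
  - by rewrite subr_eq0 (eqr_nat R _ 1) eqSS double_eq0 -lt0n (ltn_trans _ hm).
  - by rewrite subr_eq0 (eqr_nat R _ 3) eqSS -[2%N]/(1.*2) (inj_eq double_inj)
      gtn_eqF // (ltn_trans _ hm).
  (* Since nabla g = 0, differentiating e^{2p} g leaves only the derivative of the factor and the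
     terms in A; dividing by [E] gives the metric condition on A. *)
  - move=> k; pose E := expR (2 * scalar_comp p a y).
    have E0 : E != 0 by rewrite gt_eqF // expR_gt0.
    have dp : derivable (scalar_comp p a : _ -> R^o) y (delta_mx 0 k).
      by have [_ [/(_ y Uy k)]] := Ck_p 1%N.
    have := mxderive_val (mxderiveZ (is_derive_exp2 dp) (dg y k Uy)).
    move=> dE; apply/matrixP => j i.
    have := hmet k j i; rewrite cov_t02_mxE dE.
    rewrite -/E mulmxN opprK add0r -scalemxAr -scalemxAl.
    rewrite mulmxBl linearB /= mulmxBr -acm_eta_of //.
    have etaE : ((acm_eta S a y)^T *m acm_eta S a y) j i = acm_eta S a y 0 j * acm_eta S a y 0 i.
      by rewrite !mxE big_ord1 mxE.
    rewrite !(mx_addE, mx_oppE, mx_scaleE) etaE [(\row_i _) 0 k]mxE => H.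
    by apply: (mulfI E0); lra.
  - move=> k j h.
    have := htor k j h; rewrite lowerE => H.
    by rewrite !(mx_addE, mx_oppE) !conn_mx_ij -H; have [-> _] := hLC a y Uy; ring.
  - move=> k; apply/matrixP => i h.
    have := hphi k i h; rewrite cov_t11_mxE (mxderive_val (dphi y k Uy)) add0r.
    rewrite mulmxBr mulmxBl !(mx_addE, mx_oppE) => E.
    by apply/eqP; rewrite -subr_eq0 -E; apply/eqP; ring.
  - move=> k; apply/rowP => h.
    have := hxi k h; rewrite cov_vec_mxE (mxderive_val (dxi y k Uy)).
    by rewrite mul0mx add0r sub0r mulmxBr addrC => ->; rewrite mxE.
move=> k j i h; rewrite /cosymplectic_bochner (acm_eta_of S Ux).
apply: (chart_bochner_eq0 (U := cod a) (q := q a) (p := scalar_comp p a) (D := D a)) => //.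
- by move=> y Uy; exact: acm_contact_metric.
- by move=> k'; exact: dphi.
- by move=> k'; exact: dg.
- by move=> k'; exact: dxi.
- by move=> k'; apply: mxderive_smooth Ux => i' h'; rewrite ord1; exact: vec_smooth.
- move=> k' j'; apply: mxderive_smooth Ux => i' h'.
  rewrite (_ : (fun y => _) = (fun y => nabla a y j' i' h')); first exact: conn_smooth.
  by apply/funext => y; rewrite conn_mx_ij.
- by move=> y j' i' h' Uy; have [-> _] := hLC a y Uy.
- by move=> y i' Uy; have [E _ _] := det y Uy; rewrite /pv_of E mxE.
- by move=> y Uy; have [] := det y Uy.
- move=> y j' Uy; have [E _ /(_ j')] := det y Uy.
  rewrite /pv_of E => <-; by rewrite addrC subrK.
- by move=> k' j' i' h'; exact: hflat.
Qed.
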